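(* Let $0<p<\infty$ with $p\notin 2\mathbb N$. Then for every symmetric measurable set $E\subset\mathbb T$ with $|E|>0$ and every $0<q<p$, there exists $f$ in the Hardy space $H^q(\mathbb T)$ with nonnegative Fourier coefficients such that its pointwise boundary value $f^*$ belongs to $L^p(\mathbb T\setminus E)$ while $f^*\notin L^p(\mathbb T)$. Moreover, $f$ can be chosen with gaps tending to $\infty$ in its Fourier series.
   Context: $\mathbb T=\mathbb R/\mathbb Z$ with Lebesgue measure $|\cdot|$; $E$ symmetric means $E=-E$. For $q>0$, $H^q(\mathbb T)$ is the space of periodic distributions $f$ with $\hat f(n)=0$ for $n<0$ such that the functions $f_r(t)=\sum_n \hat f(n)r^{|n|}e^{2\pi i nt}$, $0<r<1$, are uniformly bounded in $L^q(\mathbb T)$, with $\|f\|_{H^q}^q=\sup_{0<r<1}\int_0^1|f_r|^q$. For $f\in H^q(\mathbb T)$, $f_r$ converges a.e. as $r\to1$ to a function $f^*\in L^q(\mathbb T)$, the pointwise boundary value. $f$ has gaps tending to $\infty$ if its Fourier series is $\sum_{k\ge0}a_k e^{2\pi i n_k x}$ with $n_k$ increasing and $n_{k+1}-n_k\to\infty$. *)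

(* Defs.v *)
From HB Require Import structures.
From mathcomp Require Import all_boot all_order all_algebra.
From mathcomp Require Import all_classical all_reals all_analysis.
Set Implicit Arguments. Unset Strict Implicit. Unset Printing Implicit Defensive.
Import Order.TTheory GRing.Theory Num.Theory.
Import numFieldNormedType.Exports.
Local Open Scope classical_set_scope.
Local Open Scope ring_scope.

(* The circle T = R/Z is modelled by [0,1] (the endpoint 1 is a null set);
   subsets of T are modelled as 1-periodic subsets of R. *)

(* R equipped with the Lebesgue (= completed, Caratheodory) sigma-algebra. *)
Definition LebT (R : realType) := caratheodory_type (@wlength R idfun)^*%mu.

Definition I01 (R : realType) : set (LebT R) := `[0%R, 1%R]%classic.
Arguments I01 R : clear implicits.

Notation Leb := (@completed_lebesgue_measure _).

(* A sequence a : nat -> R of (real) Fourier coefficients \hat f(n), n >= 0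
   (with \hat f(n) = 0 for n < 0) is the coefficient sequence of a periodic
   distribution iff it has at most polynomial growth. *)
Definition distribution_coefs (R : realType) (a : nat -> R) : Prop :=
  exists (C : R) (k : nat), forall n, `|a n| <= C * (n.+1)%:R ^+ k.

(* Real and imaginary parts of f_r(t) = sum_n \hat f(n) r^|n| e^{2 pi i n t},
   for real coefficients \hat f(n) = a n. *)
Definition fr_re (R : realType) (a : nat -> R) (r t : R) : R :=
  limn (series (fun n => a n * r ^+ n * cos (2 * pi * n%:R * t))).
Definition fr_im (R : realType) (a : nat -> R) (r t : R) : R :=
  limn (series (fun n => a n * r ^+ n * sin (2 * pi * n%:R * t))).

Definition cmod (R : realType) (x y : R) : R := Num.sqrt (x ^+ 2 + y ^+ 2).

Definition in_Hardy (R : realType) (q : R) (a : nat -> R) : Prop :=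
  distribution_coefs a /\
  exists M : R, forall r : R, 0 < r < 1 ->
    (\int[Leb]_(t in I01 R) ((cmod (fr_re a r t) (fr_im a r t)) `^ q)%:E
      <= M%:E)%E.

Definition boundary_value (R : realType) (a : nat -> R) (gre gim : R -> R) :
  Prop :=
  measurable_fun (I01 R) gre /\
  measurable_fun (I01 R) gim /\
  {ae Leb, forall t : LebT R, I01 R t ->
     (fun r => fr_re a r t) @ at_left 1 --> gre t /\
     (fun r => fr_im a r t) @ at_left 1 --> gim t}.

Definition gaps_to_infty (R : realType) (a : nat -> R) : Prop :=
  exists nk : nat -> nat,
    (forall k, (nk k < nk k.+1)%N) /\
    (forall m, a m != 0 -> exists k, m = nk k) /\
    (forall M : nat, exists K : nat, forall k, (K <= k)%N ->
        (M <= nk k.+1 - nk k)%N).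

(* Main.v *)
Require Import Defs.
From HB Require Import structures.
From mathcomp Require Import all_boot all_order all_algebra.
From mathcomp Require Import all_classical all_reals all_analysis.
From mathcomp Require Import measurable_realfun ring lra zify.
Import Order.TTheory GRing.Theory Num.Theory.
Import numFieldNormedType.Exports.
Local Open Scope classical_set_scope.
Local Open Scope ring_scope.
Set Implicit Arguments. Unset Strict Implicit. Unset Printing Implicit Defensive.

(** Write e(x) = exp(2 pi i x) and s = p / 2.  Since s is not an integer, a
three-term recurrence shows that the Fourier coefficients of |1 + e(x) / 2|^p
take both signs.  By Fejer's lemma, for a large N, multiplying a polynomial P
with nonnegative coefficients by (1 + e(N x) / 2) (1 + b e((m + k N) x))
multiplies |P|^p, in the weak sense, by a constant times
1 + beta cos(2 pi m x) + O(b^2), where beta is of order b and its sign is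
prescribed by the choice of k.  Iterating, |P|^p can be tilted by exp T for every
cosine polynomial T, hence by Weierstrass' theorem for every continuous even T:
|P|^p can imitate any even positive continuous weight, in particular one that is
close to the indicator of a symmetric set, and the frequencies used are as sparse
as desired.

Apply this to disjoint symmetric pieces F_k of E: it gives polynomials P_k with
L^p mass at least k + 1 on F_k, but tiny mass off F_k and tiny L^q mass.  Take
f = sum_k e(M_k x) P_k.  Shifting by a huge M_k makes the radial extensions
harmless: r^M (1 - r^n) <= n / (M + 1), so that |r^M P_k(r e(t))| is at most
|P_k(e(t))| plus a tiny constant, for all r < 1 at once.  Neither subharmonicity
nor a maximal function is needed. *)

Section MeanValue.
Context {R : realType}.
Implicit Types (f g h : R -> R) (a c : R) (A : set R).
Local Notation mu := (@lebesgue_measure R).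

Definition unitI : set R := `[0, 1]%classic.

Definition bounded_mfun f :=
  measurable_fun [set: R] f /\ exists M, forall x, unitI x -> `|f x| <= M.

Definition mean f : R := \int[mu]_(x in unitI) f x.

Lemma measurable_unitI : measurable unitI.
Proof. exact: measurable_itv. Qed.

Lemma lebesgue_measure_unitI : mu unitI = 1%:E.
Proof. by rewrite /unitI lebesgue_measure_itv/= lte_fin ltr01 oppr0 adde0. Qed.

Lemma unitI_subset_fin_num A : measurable A -> A `<=` unitI -> mu A \is a fin_num.
Proof.
move=> mA AI; rewrite ge0_fin_numE ?measure_ge0//.
apply: (@le_lt_trans _ _ (mu unitI)); last by rewrite lebesgue_measure_unitI ltry.
by apply: le_measure; rewrite ?inE//; exact: measurable_unitI.
Qed.

Lemma bounded_mfun_cst c : bounded_mfun (fun=> c).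
Proof. by split; [exact: measurable_cst | exists `|c|]. Qed.

Lemma bounded_mfunD f g :
  bounded_mfun f -> bounded_mfun g -> bounded_mfun (fun x => f x + g x).
Proof.
move=> [mf [M fM]] [mg [N gN]]; split; first exact: measurable_funD.
by exists (M + N) => x Ix; rewrite (le_trans (ler_normD _ _))// lerD ?fM ?gN.
Qed.

Lemma bounded_mfunM f g :
  bounded_mfun f -> bounded_mfun g -> bounded_mfun (fun x => f x * g x).
Proof.
move=> [mf [M fM]] [mg [N gN]]; split; first exact: measurable_funM.
by exists (M * N) => x Ix; rewrite normrM ler_pM ?fM ?gN.
Qed.

Lemma bounded_mfunN f : bounded_mfun f -> bounded_mfun (fun x => - f x).
Proof.
move=> [mf [M fM]]; split; first exact: measurableT_comp.
by exists M => x Ix; rewrite normrN fM.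
Qed.

Lemma bounded_mfun_norm f : bounded_mfun f -> bounded_mfun (fun x => `|f x|).
Proof.
move=> [mf [M fM]]; split; first exact: measurableT_comp.
by exists M => x Ix; rewrite normr_id fM.
Qed.

Lemma bounded_mfun_indic A : measurable A -> bounded_mfun (\1_A).
Proof.
move=> mA; split; first exact: measurable_indic.
by exists 1 => x _; rewrite indicE; case: (_ \in _); rewrite ?normr0 ?normr1.
Qed.

Lemma continuous_bounded_mfun f : continuous f -> bounded_mfun f.
Proof.
move=> cf; split; first exact: continuous_measurable_fun.
have /compact_bounded[M [_ fM]] : compact (f @` unitI).
  by apply: continuous_compact; [exact: continuous_subspaceT|exact: segment_compact].
exists (M + 1) => x Ix; apply: (fM (M + 1)); first by rewrite ltrDl.
by exists x.
Qed.

Lemma bounded_mfun_expR f : bounded_mfun f -> bounded_mfun (fun x => expR (f x)).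
Proof.
move=> [mf [M fM]]; split; first exact: measurableT_comp.
exists (expR M) => x Ix; rewrite ger0_norm ?expR_ge0// ler_expR.
by rewrite (le_trans _ (fM x Ix))// ler_norm.
Qed.

Lemma bounded_mfun_powR f a : 0 <= a -> (forall x, 0 <= f x) -> bounded_mfun f ->
  bounded_mfun (fun x => f x `^ a).
Proof.
move=> a0 f0 [mf [M fM]]; split.
  by apply: (measurableT_comp (measurable_powR a)).
exists (M `^ a) => x /fM fxM; rewrite ger0_norm ?powR_ge0// ge0_ler_powR//.
- exact: f0.
- by rewrite nnegrE (le_trans _ fxM).
- by rewrite (le_trans _ fxM)// ler_norm.
Qed.

Lemma bounded_mfun_onem h : bounded_mfun h -> bounded_mfun (fun x => h (1 - x)).
Proof.
move=> [mh [M hM]]; split; first exact: (measurableT_comp mh (measurable_funB _ _)).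
exists M => x; rewrite /unitI/= in_itv/= => /andP[x0 x1]; apply: hM.
by rewrite /unitI/= in_itv/=; apply/andP; split; lra.
Qed.

Lemma bounded_mfun_integrable f A : measurable A -> A `<=` unitI ->
  bounded_mfun f -> mu.-integrable A (EFin \o f).
Proof.
move=> mA AI [mf [M fM]]; apply: measurable_bounded_integrable => //.
- by rewrite -ge0_fin_numE ?measure_ge0// unitI_subset_fin_num.
- exact: measurable_funTS.
- exists M; split; [by rewrite num_real | move=> N MN x Ax /=].
  exact: le_trans (fM x (AI x Ax)) (ltW MN).
Qed.

Lemma unitI_integrable f : bounded_mfun f -> mu.-integrable unitI (EFin \o f).
Proof. by apply: bounded_mfun_integrable => //; exact: measurable_unitI. Qed.

Lemma meanD f g : bounded_mfun f -> bounded_mfun g ->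
  mean (fun x => f x + g x) = mean f + mean g.
Proof.
move=> bf bg; rewrite /mean RintegralD//.
- exact: measurable_unitI.
- exact: unitI_integrable.
- exact: unitI_integrable.
Qed.

Lemma meanZ c f : bounded_mfun f -> mean (fun x => c * f x) = c * mean f.
Proof.
by move=> bf; rewrite /mean RintegralZl//;
  [exact: measurable_unitI|exact: unitI_integrable].
Qed.

Lemma meanN f : bounded_mfun f -> mean (fun x => - f x) = - mean f.
Proof.
by move=> bf; rewrite -mulN1r -meanZ//; congr mean; apply/funext => x; rewrite mulN1r.
Qed.

Lemma meanB f g : bounded_mfun f -> bounded_mfun g ->
  mean (fun x => f x - g x) = mean f - mean g.
Proof. by move=> bf bg; rewrite meanD ?meanN//; exact: bounded_mfunN. Qed.

Lemma mean_cst c : mean (fun=> c) = c.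
Proof.
rewrite /mean Rintegral_cst; last exact: measurable_unitI.
by rewrite -[X in fine X]/(mu unitI) lebesgue_measure_unitI mulr1.
Qed.

Lemma le_mean f g : bounded_mfun f -> bounded_mfun g ->
  (forall x, unitI x -> f x <= g x) -> mean f <= mean g.
Proof.
move=> bf bg fg; apply: le_Rintegral => //; first exact: measurable_unitI.
- exact: unitI_integrable.
- exact: unitI_integrable.
Qed.

Lemma eq_mean f g : (forall x, unitI x -> f x = g x) -> mean f = mean g.
Proof. by move=> fg; apply: eq_Rintegral => x; rewrite inE; exact: fg. Qed.

Lemma mean_ge0 f : (forall x, unitI x -> 0 <= f x) -> 0 <= mean f.
Proof. by move=> f0; exact: Rintegral_ge0. Qed.

Lemma norm_mean_le f : bounded_mfun f -> `|mean f| <= mean (fun x => `|f x|).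
Proof.
move=> bf; apply: le_normr_Rintegral; first exact: measurable_unitI.
exact: unitI_integrable.
Qed.

Lemma norm_mean_le_bound f c : bounded_mfun f -> (forall x, unitI x -> `|f x| <= c) ->
  `|mean f| <= c.
Proof.
move=> bf fc; rewrite (le_trans (norm_mean_le bf))// -[leRHS]mean_cst.
apply: le_mean => //; [exact: bounded_mfun_norm|exact: bounded_mfun_cst].
Qed.

Lemma integral_mean f : bounded_mfun f ->
  (\int[mu]_(x in unitI) (f x)%:E)%E = (mean f)%:E.
Proof.
move=> bf; rewrite /mean /Rintegral fineK//.
by apply: integrable_fin_num; [exact: measurable_unitI|exact: unitI_integrable].
Qed.

Lemma integral_mean_indic A f : measurable A -> A `<=` unitI -> bounded_mfun f ->
  (\int[mu]_(x in A) (f x)%:E)%E = (mean (fun x => \1_A x * f x))%:E.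
Proof.
move=> mA AI bf; rewrite -integral_mean; last first.
  by apply: bounded_mfunM => //; exact: bounded_mfun_indic.
rewrite -{1}(setIidr AI) integral_mkcondr; apply: eq_integral => x _.
by rewrite patchE indicE; case: (x \in A); rewrite ?mul1r ?mul0r.
Qed.

Lemma lebesgue_measure_mean A : measurable A -> A `<=` unitI -> mu A = (mean (\1_A))%:E.
Proof.
move=> mA AI; rewrite /mean /Rintegral integral_indic//; last exact: measurable_unitI.
by rewrite setIidl// fineK// unitI_subset_fin_num.
Qed.

Lemma mean_derive (F f : R -> R) : (forall x : R, -1 < x < 2 -> is_derive x 1 F (f x)) ->
  continuous f -> mean f = F 1 - F 0.
Proof.
move=> dF cf; have cF (x : R) : -1 < x < 2 -> {for x, continuous F}.
  by move=> /dF[dFx _]; exact/differentiable_continuous/derivable1_diffP.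
rewrite /mean /Rintegral (@continuous_FTC2 _ f F)//.
- exact: continuous_subspaceT.
- split; first by move=> x; rewrite in_itv/= => x01; case: (dF x) => //; lra.
  + by apply: cvg_at_right_filter; apply: cF; lra.
  + by apply: cvg_at_left_filter; apply: cF; lra.
- by move=> x; rewrite in_itv/= => x01; rewrite derive1E; case: (dF x) => //; lra.
Qed.

Lemma continuous_mean_approx f eps : bounded_mfun f -> 0 < eps ->
  exists2 g, continuous g & mean (fun x => `|f x - g x|) < eps.
Proof.
move=> bf eps0.
have muI : (mu unitI < +oo)%E by rewrite lebesgue_measure_unitI ltry.
have [g [cg _ /fine_cvgP[_ /cvgrPdist_lt/(_ _ eps0)[n _ gn]]]] :=
  approximation_continuous_integrable measurable_unitI muI (unitI_integrable bf).
exists (g n) => //; have := gn n (leqnn n).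
by rewrite /= sub0r normrN; exact/le_lt_trans/ler_norm.
Qed.

Definition reflection (x : R) : R := 1 - x.

Lemma measurable_reflection : measurable_fun [set: R] reflection.
Proof. exact: measurable_funB. Qed.

Lemma lebesgue_measure_reflection A : measurable A -> mu (reflection @^-1` A) = mu A.
Proof.
move=> mA; rewrite -[LHS]/(pushforward mu (reflection : _ -> measurableTypeR R) A).
apply/esym/lebesgue_measure_unique => //=; first exact: measurable_reflection.
move=> _ _ [[a b]] _ <-; rewrite /pushforward.
have -> : reflection @^-1` `]a, b]%classic = `[1 - b, 1 - a[%classic.
  by apply/seteqP; split => x /=; rewrite !in_itv/= /reflection; lra.
rewrite !lebesgue_measure_itv/= !lte_fin ltrD2l ltrN2; case: ifPn => // _.
by rewrite -!EFinD; congr EFin; ring.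
Qed.

Lemma mean_onem h : bounded_mfun h -> mean (fun x => h (1 - x)) = mean h.
Proof.
move=> bh; have [mh _] := bh.
have preimage_reflection_unitI : reflection @^-1` unitI = unitI.
  by apply/seteqP; split => x /=; rewrite /unitI/= !in_itv/= /reflection; lra.
rewrite /mean /Rintegral; congr fine.
transitivity (\int[pushforward mu (reflection : _ -> measurableTypeR R)]_(x in unitI)
    (h x)%:E)%E.
  rewrite integral_pushforward//= ?preimage_reflection_unitI//.
  - exact: measurable_reflection.
  - exact/measurable_EFinP.
  - exact/unitI_integrable/bounded_mfun_onem.
  - exact: measurable_unitI.
apply: eq_measure_integral => //=; first exact: measurable_reflection.
by move=> _ A mA _; exact: lebesgue_measure_reflection.
Qed.

Lemma mean_antisymmetric h : bounded_mfun h -> (forall x, h (1 - x) = - h x) ->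
  mean h = 0.
Proof.
move=> bh hN; have := mean_onem bh.
rewrite (_ : (fun x => h (1 - x)) = fun x => - h x); last exact/funext.
by rewrite meanN//; lra.
Qed.

End MeanValue.
#[local] Hint Resolve bounded_mfun_cst bounded_mfunD bounded_mfunM bounded_mfunN
  bounded_mfun_norm bounded_mfun_expR bounded_mfun_onem : bounded_mfun.
#[local] Hint Resolve bounded_mfun_indic continuous_bounded_mfun : bounded_mfun.


Section TaylorEstimates.
Context {R : realType}.
Implicit Types (f df ddf : R -> R) (x y s t : R).

Lemma MVT_between f df x y :
  (forall z, `|z - x| <= `|y - x| -> is_derive z 1 f (df z)) ->
  exists2 z, `|z - x| <= `|y - x| & f y - f x = df z * (y - x).
Proof.
move=> der; have cf z : `|z - x| <= `|y - x| -> {for z, continuous f}.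
  by move=> /der[dfz _]; exact/differentiable_continuous/derivable1_diffP.
have [xy|/ltW yx] := leP x y.
  have near_x z : x <= z <= y -> `|z - x| <= `|y - x|.
    by move=> xzy; rewrite !ger0_norm; lra.
  have [z||w] := @MVT_segment _ f df _ _ xy.
  - by rewrite in_itv/= => xzy; apply/der/near_x; lra.
  - apply: continuous_in_subspaceT => z; rewrite inE/= in_itv/= => xzy.
    exact/cf/near_x.
  - by rewrite in_itv/= => /near_x wx fE; exists w.
have near_x z : y <= z <= x -> `|z - x| <= `|y - x|.
  by move=> yzx; rewrite !ler0_norm; lra.
have [z||w] := @MVT_segment _ f df _ _ yx.
- by rewrite in_itv/= => yzx; apply/der/near_x; lra.
- apply: continuous_in_subspaceT => z; rewrite inE/= in_itv/= => yzx.
  exact/cf/near_x.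
- rewrite in_itv/= => /near_x wx fE; exists w => //.
  by rewrite -opprB fE; ring.
Qed.

Lemma tangent_error f df ddf x y (K : R) :
  (forall z, `|z - x| <= `|y - x| ->
    [/\ is_derive z 1 f (df z), is_derive z 1 df (ddf z) & `|ddf z| <= K]) ->
  `|f y - f x - df x * (y - x)| <= K * (y - x) ^+ 2.
Proof.
move=> der; have [z zx ->] := @MVT_between f df x y (fun z hz => let: And3 d _ _ := der z hz in d).
have near_x w : `|w - x| <= `|z - x| -> `|w - x| <= `|y - x|.
  by move=> /le_trans; apply.
have [w wz dfE] := @MVT_between df ddf x z
  (fun w hw => let: And3 _ d _ := der w (near_x w hw) in d).
have [_ _ ddfK] := der w (near_x w wz).
rewrite -mulrBl dfE -(real_normK (num_real (y - x))) !normrM expr2 mulrA.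
by rewrite ler_wpM2r// ler_pM.
Qed.

Lemma powR_le_base2 a x : 2^-1 <= x <= 2 -> x `^ a <= 2 `^ `|a|.
Proof.
move=> /andP[x2 x2']; have x0 : 0 < x by rewrite (lt_le_trans _ x2)// invr_gt0.
have [a0|a0] := ger0P a; first by rewrite ge0_ler_powR// nnegrE ltW.
have -> : x `^ a = x^-1 `^ (- a) by rewrite -powR_inv1 ?ltW// -powRrM mulN1r opprK.
rewrite ge0_ler_powR ?nnegrE ?invr_ge0 ?oppr_ge0 ?(ltW a0) ?(ltW x0)//.
by rewrite invf_ple ?posrE.
Qed.

Lemma powR_tangent_error s : exists2 C, 0 < C & forall t, `|t| <= 2^-1 ->
  `|(1 + t) `^ s - (1 + s * t)| <= C * t ^+ 2.
Proof.
pose C : R := `|s * (s - 1)| * 2 `^ `|s - 1 - 1|.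
exists (C + 1) => [|t t2]; first by rewrite ltr_wpDl// mulr_ge0 ?powR_ge0.
apply: (@le_trans _ _ (C * t ^+ 2)); last by rewrite ler_wpM2r ?sqr_ge0// lerDl.
have -> : (1 + t) `^ s - (1 + s * t) =
    (1 + t) `^ s - 1 `^ s - s * 1 `^ (s - 1) * (1 + t - 1).
  by rewrite !powR1; ring.
rewrite [X in _ <= _ * X ^+ 2](_ : t = 1 + t - 1); last by ring.
apply: (@tangent_error (fun z => z `^ s) (fun z => s * z `^ (s - 1))
  (fun z => s * ((s - 1) * z `^ (s - 1 - 1))) 1 (1 + t)) => z.
have -> : 1 + t - 1 = t by ring.
move=> zt.
have z2 : 2^-1 <= z <= 2.
  have : `|z - 1| <= 1 / 2 by rewrite div1r (le_trans zt).
  by rewrite -div1r ler_norml; lra.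
have z0 : 0 < z by rewrite (lt_le_trans _ (proj1 (andP z2)))// invr_gt0.
split.
- exact: is_derive1_powR.
- have := is_derive1_powR (s - 1) z0 => dpow.
  by apply: is_derive_eq; rewrite /GRing.scale.
- rewrite mulrA normrM /C ler_wpM2l// ger0_norm ?powR_ge0//.
  exact: powR_le_base2.
Qed.

End TaylorEstimates.

Section Weierstrass.
Context {R : realType}.
Implicit Types (v eps : R) (n : nat).

Lemma compact_modulus (T : topologicalType) (K : set T) (f u : T -> R) eps :
  compact K -> continuous f -> continuous u ->
  (forall x y, K x -> K y -> u x = u y -> f x = f y) -> 0 < eps ->
  exists2 k, 0 <= k &
    forall x y, K x -> K y -> `|f x - f y| <= eps + k * (u x - u y) ^+ 2.
Proof.
move=> cK cf cu fu eps0.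
pose df (z : T * T) := `|f z.1 - f z.2|; pose du (z : T * T) := (u z.1 - u z.2) ^+ 2.
have cdiff (g : T -> R) : continuous g -> continuous (fun z : T * T => g z.1 - g z.2).
  by move=> cg z; apply: cvgB; apply: continuous_comp; rewrite //=;
    [exact: cvg_fst|exact: cg|exact: cvg_snd|exact: cg].
have cdf : continuous df by move=> z; apply: cvg_norm; exact: cdiff.
have cdu : continuous du by move=> z; rewrite /du; apply: cvgM; exact: cdiff.
have /compact_near_coveringP/near_covering_withinP := compact_setX cK cK.
move=> /(_ R +oo%R (fun k z => df z <= eps + k * du z) _)[[x y] [/= Kx Ky]|M [_ hM]].
  have [uxy|uxy] := eqVneq (u x) (u y).
    exists ([set z | df z < eps], [set k | 0 <= k]) => /= [|[z k] [/= zeps k0] _].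
      split=> /=; last by apply: nbhs_pinfty_ge; rewrite num_real.
      by apply: cvgr_lt (cdf _) _ _; rewrite /df/= (fu x y)// subrr normr0.
    by rewrite ler_wpDr ?(ltW zeps)// mulr_ge0 ?sqr_ge0.
  have c0 : 0 < du (x, y) / 2 by rewrite divr_gt0// exprn_even_gt0//= subr_eq0.
  set c := _ / 2 in c0.
  exists ([set z | df z < df (x, y) + 1 /\ c < du z], [set k | (df (x, y) + 1) / c <= k]).
    split=> /=; last by apply: nbhs_pinfty_ge; rewrite num_real.
    near=> z; split; near: z.
      by apply: cvgr_lt (cdf _) _ _; rewrite ltrDl.
    by apply: cvgr_gt (cdu _) _ _; move: c0; rewrite /c; lra.
  move=> [z k] [/= [zd /ltW zc] ck] _.
  have k0 : 0 <= k by rewrite (le_trans _ ck)// divr_ge0 ?(ltW c0)// addr_ge0 ?normr_ge0.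
  rewrite (le_trans (ltW zd))// ler_wpDl ?(ltW eps0)// (@le_trans _ _ (k * c))//.
    by rewrite -ler_pdivrMr.
  by rewrite ler_wpM2l.
have M1 : M < `|M| + 1 by rewrite (le_lt_trans (ler_norm M))// ltrDl.
exists (`|M| + 1) => [|x y Kx Ky]; first by rewrite addr_ge0.
exact: (hM _ M1 (x, y)).
Unshelve. all: by end_near. Qed.

Definition bernstein n i v : R := (v ^+ i * (1 - v) ^+ (n - i)) *+ 'C(n, i).

Lemma bernstein_ge0 n i v : 0 <= v <= 1 -> 0 <= bernstein n i v.
Proof.
move=> /andP[v0 v1]; rewrite mulrn_wge0// mulr_ge0// exprn_ge0//.
by rewrite subr_ge0.
Qed.

Lemma sum_bernstein n v : \sum_(i < n.+1) bernstein n i v = 1.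
Proof.
transitivity ((1 - v + v) ^+ n); last by rewrite subrK expr1n.
by rewrite exprDn; apply: eq_bigr => i _; rewrite mulrC.
Qed.

Lemma sum_natr_bernstein n v (f : nat -> R) :
  \sum_(i < n.+2) i%:R * f i * bernstein n.+1 i v =
  n.+1%:R * v * \sum_(i < n.+1) f i.+1 * bernstein n i v.
Proof.
rewrite big_ord_recl !mul0r add0r mulr_sumr; apply: eq_bigr => i _.
rewrite /bernstein lift0 subSS exprS -[_ *+ _]mulr_natr -[X in _ = _ * (_ * X)]mulr_natr.
have : i.+1%:R * 'C(n.+1, i.+1)%:R = n.+1%:R * 'C(n, i)%:R :> R.
  by rewrite -!natrM -mul_bin_diag.
set a := i.+1%:R; set b := 'C(_, _)%:R; set a' := n.+1%:R; set b' := 'C(_, _)%:R => ab.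
transitivity ((a * b) * f i.+1 * v * v ^+ i * (1 - v) ^+ (n - i)); first by ring.
by rewrite ab; ring.
Qed.

Lemma bernstein_variance n v :
  \sum_(i < n.+2) (v - i%:R / n.+1%:R) ^+ 2 * bernstein n.+1 i v =
  v * (1 - v) / n.+1%:R.
Proof.
have sum1 : \sum_(i < n.+2) i%:R * bernstein n.+1 i v = n.+1%:R * v.
  under eq_bigr do rewrite -[_%:R]mulr1.
  rewrite (sum_natr_bernstein _ _ (fun=> 1)).
  by under eq_bigr do rewrite mul1r; rewrite sum_bernstein mulr1.
have sum2 : \sum_(i < n.+2) i%:R ^+ 2 * bernstein n.+1 i v =
    n.+1%:R * v * (n%:R * v + 1).
  under eq_bigr do rewrite expr2.
  rewrite (sum_natr_bernstein _ _ (fun i => i%:R)); congr (_ * _).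
  under eq_bigr do rewrite -natr1 mulrDl mul1r.
  rewrite big_split/= sum_bernstein; congr (_ + _).
  case: n {sum1} => [|n]; first by rewrite big_ord1 !mul0r.
  under eq_bigr do rewrite -[_%:R]mulr1.
  rewrite (sum_natr_bernstein _ _ (fun=> 1)).
  by under eq_bigr do rewrite mul1r; rewrite sum_bernstein mulr1.
have n0 : 1 + n%:R != 0 :> R by rewrite addrC natr1 pnatr_eq0.
transitivity (v ^+ 2 * \sum_(i < n.+2) bernstein n.+1 i v
    - 2 * v / n.+1%:R * \sum_(i < n.+2) i%:R * bernstein n.+1 i v
    + n.+1%:R ^- 2 * \sum_(i < n.+2) i%:R ^+ 2 * bernstein n.+1 i v).
  rewrite !mulr_sumr -sumrB -big_split/=; apply: eq_bigr => i _.
  by rewrite -!natr1; field.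
by rewrite sum_bernstein sum1 sum2 -natr1; field.
Qed.

(* Bernstein's proof, run on the values of [u]: the variance bound makes the
   weight [bernstein n i (u x)] concentrate on the nodes where [u] is close to
   [u x], and there [f] is close to [f x] by [compact_modulus]. *)
Theorem weierstrass_factor (T : topologicalType) (K : set T) (f u : T -> R) eps :
  compact K -> continuous f -> continuous u -> u @` K = `[0, 1]%classic ->
  (forall x y, K x -> K y -> u x = u y -> f x = f y) -> 0 < eps ->
  exists p : {poly R}, forall x, K x -> `|f x - p.[u x]| <= eps.
Proof.
move=> cK cf cu uK fu eps0; have eps2 : 0 < eps / 2 by rewrite divr_gt0.
have [k k0 hk] := compact_modulus cK cf cu fu eps2.
pose n := Num.bound (k / (eps / 2)).
have kn : k / n.+1%:R <= eps / 2.
  rewrite ler_pdivrMr ?ltr0n// mulrC -ler_pdivrMr// ltW//.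
  by rewrite (lt_trans (archi_boundP _)) ?ltr_nat// divr_ge0// ltW.
have /choice[node nodeP] : forall i : 'I_n.+2, exists x, K x /\ u x = i%:R / n.+1%:R.
  move=> i; have : (u @` K) (i%:R / n.+1%:R); last by move=> [x Kx ux]; exists x.
  rewrite uK/= in_itv/= divr_ge0//= ler_pdivrMr ?ltr0n// mul1r ler_nat.
  by rewrite -ltnS ltn_ord.
exists (\sum_(i < n.+2) f (node i) *: (('X^i * (1 - 'X) ^+ (n.+1 - i)) *+ 'C(n.+1, i))).
move=> x Kx; have /andP[ux0 ux1] : 0 <= u x <= 1.
  have : (u @` K) (u x) by exists x.
  by rewrite uK/= in_itv.
have hornE : (\sum_(i < n.+2) f (node i) *: (('X^i * (1 - 'X) ^+ (n.+1 - i)) *+ 'C(n.+1, i))).[u x]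
    = \sum_(i < n.+2) f (node i) * bernstein n.+1 i (u x).
  rewrite horner_sum; apply: eq_bigr => i _.
  by rewrite hornerZ hornerMn hornerM hornerXn horner_exp !hornerE.
rewrite hornE -[f x]mulr1 -(sum_bernstein n.+1 (u x)) mulr_sumr -sumrB.
apply: (le_trans (ler_norm_sum _ _ _)).
apply: (@le_trans _ _ (\sum_(i < n.+2) (eps / 2 * bernstein n.+1 i (u x) +
    k * ((u x - i%:R / n.+1%:R) ^+ 2 * bernstein n.+1 i (u x))))).
  apply: ler_sum => i _; have [Ki uiE] := nodeP i.
  have b0 : 0 <= bernstein n.+1 i (u x) by rewrite bernstein_ge0// ux0.
  by rewrite -mulrBl normrM (ger0_norm b0) mulrA -mulrDl ler_wpM2r// -uiE; exact: hk.
rewrite big_split/= -!mulr_sumr sum_bernstein bernstein_variance mulr1.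
rewrite [leRHS](splitr eps) lerD2l (le_trans _ kn)// ler_wpM2l//.
by rewrite ler_piMl ?invr_ge0//; nra.
Qed.

End Weierstrass.

Section CircleHarmonics.
Context {R : realType}.
Implicit Types (x eps : R) (m n : nat).

Definition ecos n x : R := cos (2 * pi * n%:R * x).
Definition esin n x : R := sin (2 * pi * n%:R * x).

Lemma ecos0 x : ecos 0 x = 1.
Proof. by rewrite /ecos mulr0 mul0r cos0. Qed.

Lemma esin0 x : esin 0 x = 0.
Proof. by rewrite /esin mulr0 mul0r sin0. Qed.

Lemma ecosD m n x : ecos (m + n) x = ecos m x * ecos n x - esin m x * esin n x.
Proof. by rewrite /ecos /esin natrD mulrDr mulrDl cosD. Qed.

Lemma esinD m n x : esin (m + n) x = esin m x * ecos n x + ecos m x * esin n x.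
Proof. by rewrite /ecos /esin natrD mulrDr mulrDl sinD. Qed.

Lemma ecosB m n x : (n <= m)%N ->
  ecos (m - n) x = ecos m x * ecos n x + esin m x * esin n x.
Proof. by move=> nm; rewrite /ecos /esin natrB// mulrBr mulrBl cosB. Qed.

Lemma ecos2Desin2 n x : ecos n x ^+ 2 + esin n x ^+ 2 = 1.
Proof. exact: cos2Dsin2. Qed.

Lemma ecos_norm n x : `|ecos n x| <= 1.
Proof. exact: cos_max. Qed.

Lemma esin_norm n x : `|esin n x| <= 1.
Proof. exact: sin_max. Qed.

Lemma ecos_natrM n m x : ecos n (m%:R * x) = ecos (n * m) x.
Proof. by rewrite /ecos natrM !mulrA. Qed.

Lemma esin_natrM n m x : esin n (m%:R * x) = esin (n * m) x.
Proof. by rewrite /esin natrM !mulrA. Qed.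

Lemma ecos_periodic n : periodic (ecos n) (1 : R).
Proof.
move=> x; rewrite /ecos mulrDr mulr1 [2 * pi]mulr_natl mulr_natr.
exact: (periodicn (@cosD2pi R)).
Qed.

Lemma esin_periodic n : periodic (esin n) (1 : R).
Proof.
move=> x; rewrite /esin mulrDr mulr1 [2 * pi]mulr_natl mulr_natr.
exact: (periodicn (@sinD2pi R)).
Qed.

Lemma ecos_onem n x : ecos n (1 - x) = ecos n x.
Proof. by rewrite addrC ecos_periodic /ecos mulrN cosN. Qed.

Lemma esin_onem n x : esin n (1 - x) = - esin n x.
Proof. by rewrite addrC esin_periodic /esin mulrN sinN. Qed.

Lemma is_derive_ecos n x : is_derive x 1 (ecos n) (- (2 * pi * n%:R) * esin n x).
Proof.
have -> : ecos n = cos \o (fun y => 2 * pi * n%:R * y) by [].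
apply: is_derive_eq; rewrite /esin; set a := 2 * pi * n%:R.
by rewrite /GRing.scale/=; ring.
Qed.

Lemma is_derive_esin n x : is_derive x 1 (esin n) (2 * pi * n%:R * ecos n x).
Proof.
have -> : esin n = sin \o (fun y => 2 * pi * n%:R * y) by [].
apply: is_derive_eq; rewrite /ecos; set a := 2 * pi * n%:R.
by rewrite /GRing.scale/=; ring.
Qed.

Lemma is_derive_continuous (F f : R -> R) :
  (forall x, is_derive x 1 F (f x)) -> continuous F.
Proof.
by move=> dF x; apply/differentiable_continuous/derivable1_diffP; case: (dF x).
Qed.

Lemma continuous_ecos n : continuous (ecos n).
Proof. by apply: is_derive_continuous => x; exact: is_derive_ecos. Qed.

Lemma continuous_esin n : continuous (esin n).
Proof. by apply: is_derive_continuous => x; exact: is_derive_esin. Qed.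

Lemma bounded_mfun_ecos n : bounded_mfun (ecos n).
Proof. exact/continuous_bounded_mfun/continuous_ecos. Qed.

Lemma bounded_mfun_esin n : bounded_mfun (esin n).
Proof. exact/continuous_bounded_mfun/continuous_esin. Qed.

Lemma ecos1_eq x y : unitI x -> unitI y -> ecos 1 x = ecos 1 y -> x = y \/ x = 1 - y.
Proof.
have pi0 := @pi_gt0 R.
have fold z : unitI z -> exists2 w, 0 <= w <= 1 / 2 &
    ecos 1 z = ecos 1 w /\ (z = w \/ z = 1 - w).
  rewrite /unitI/= in_itv/= => z01; have [z2|z2] := leP z (1 / 2).
    by exists z; [lra|split; [|left]].
  by exists (1 - z); [lra|rewrite ecos_onem; split; [|right; rewrite subKr]].
move=> /fold[v v01 [-> xv]] /fold[w w01 [-> yw]]; rewrite /ecos mulr1.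
have vw : v = w -> x = y \/ x = 1 - y.
  by move=> vwE; subst w; case: xv => ->; case: yw => ->; (by left) || right; rewrite ?subKr.
move=> /cos_inj inj; apply: vw; apply: (@mulfI _ (2 * pi)).
  by rewrite mulf_neq0// gt_eqF.
by apply: inj; rewrite in_itv/=; nra.
Qed.

Lemma image_half_ecos1 :
  (fun x => (1 + ecos 1 x) / 2) @` unitI = `[0, 1]%classic.
Proof.
have pi0 := @pi_gt0 R; apply/seteqP; split => [_ [x _ <-]|v] /=.
  by have := ecos_norm 1 x; rewrite ler_norml in_itv/=; lra.
rewrite in_itv/= => v01; have v11 : -1 <= 2 * v - 1 <= 1 by lra.
exists (acos (2 * v - 1) / (2 * pi)).
  have := acos_ge0 v11; have := acos_lepi v11; rewrite /unitI/= in_itv/= => a1 a0.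
  by rewrite ler_pdivrMr ?mulr_gt0// divr_ge0//=; nra.
rewrite /ecos mulr1 [2 * pi * _]mulrC divfK ?mulf_neq0 ?gt_eqF// acosK ?in_itv//=.
by field.
Qed.

Lemma symmetric_poly_ecos1 (f : R -> R) eps : continuous f ->
  (forall x, unitI x -> f (1 - x) = f x) -> 0 < eps ->
  exists p : {poly R}, forall x, unitI x -> `|f x - p.[ecos 1 x]| <= eps.
Proof.
move=> cf sf eps0; pose u x := (1 + ecos 1 x) / 2.
have cu : continuous u.
  move=> x; apply: cvgM; last exact: cvg_cst.
  by apply: cvgD; [exact: cvg_cst|exact: continuous_ecos].
have fu x y : unitI x -> unitI y -> u x = u y -> f x = f y.
  move=> Ix Iy uE; have /(ecos1_eq Ix Iy)[->//|->] : ecos 1 x = ecos 1 y.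
    by move: uE; rewrite /u; lra.
  exact: sf.
have [p hp] := weierstrass_factor (@segment_compact R 0 1) cf cu image_half_ecos1 fu eps0.
exists (p \Po (2^-1 *: (1 + 'X))) => x /hp; rewrite horner_comp !hornerE.
by rewrite /u mulrC.
Qed.

End CircleHarmonics.
#[local] Hint Resolve bounded_mfun_ecos bounded_mfun_esin : bounded_mfun.

Section Fejer.
Context {R : realType}.
Implicit Types (f g h : R -> R) (a b x eps : R).
Local Notation mu := (@lebesgue_measure R).

Lemma continuous_primitive f a b : continuous f ->
  exists F, forall x, a < x < b -> is_derive x 1 F (f x).
Proof.
move=> cf; exists (fun x => \int[mu]_(t in `[a, x]) f t) => x /andP[ax xb].
have intf : mu.-integrable `[a, b] (EFin \o f).
  apply: continuous_compact_integrable; first exact: segment_compact.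
  exact: continuous_subspaceT.
have [dF FE] := continuous_FTC1_closed xb intf ax (cf x).
by apply: DeriveDef; [exact: dF|rewrite -derive1E; exact: FE].
Qed.

Lemma mean_dissect f n : continuous f ->
  mean f = n.+1%:R^-1 * \sum_(0 <= i < n.+1) mean (fun x => f ((i%:R + x) / n.+1%:R)).
Proof.
move=> cf; have [F dF] := continuous_primitive (-1) 2 cf.
have N0 : 0 < n.+1%:R :> R by rewrite ltr0n.
have pieceE i : (i < n.+1)%N -> mean (fun x => f ((i%:R + x) / n.+1%:R)) =
    n.+1%:R * (F (i.+1%:R / n.+1%:R) - F (i%:R / n.+1%:R)).
  move=> lein; pose l x : R := (i%:R + x) / n.+1%:R.
  have cl : continuous l.
    by move=> x; apply: cvgM; [apply: cvgD; [exact: cvg_cst|exact: cvg_id]|exact: cvg_cst].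
  have dFl x : -1 < x < 2 -> is_derive x 1 (fun y => n.+1%:R * F (l y)) (f (l x)).
    move=> x12; have dl : is_derive x 1 l n.+1%:R^-1.
      rewrite (_ : l = n.+1%:R^-1 \*: (cst i%:R + id)); last first.
        by apply/funext => y; rewrite /l mulrC.
      by apply: is_derive_eq; rewrite add0r /GRing.scale/= mulr1.
    have dF' : is_derive (l x) 1 F (f (l x)).
      apply: dF; rewrite ltr_pdivlMr// ltr_pdivrMr//.
      have i0 : 0 <= i%:R :> R by []; have n0 : 0 <= n%:R :> R by [].
      have : i%:R <= n%:R :> R by rewrite ler_nat -ltnS.
      by rewrite -natr1; lra.
    rewrite (_ : (fun y => _) = n.+1%:R \*: (F \o l))//.
    by apply: is_derive_eq; rewrite /GRing.scale/= mulrC divfK ?lt0r_neq0.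
  have cfl : continuous (f \o l) by move=> x; apply: continuous_comp; [exact: cl|exact: cf].
  by rewrite (mean_derive dFl cfl) /l addr0 natr1 mulrBr.
rewrite big_nat; under eq_bigr => i /andP[_ lein] do rewrite pieceE//.
rewrite -big_nat -mulr_sumr telescope_sumr// mulrA mulVf ?lt0r_neq0//.
rewrite mul1r mul0r divff ?lt0r_neq0//.
by apply: mean_derive.
Qed.

Lemma mean_mul_near_const f g c M eps : bounded_mfun f -> bounded_mfun g ->
  (forall x, unitI x -> `|f x - c| <= eps) -> (forall x, unitI x -> `|g x| <= M) ->
  `|mean (fun x => f x * g x) - mean f * mean g| <= 2 * eps * M.
Proof.
move=> bf bg fc gM; pose d x := f x - c.
have bd : bounded_mfun d by rewrite /d; auto with bounded_mfun.
have -> : mean (fun x => f x * g x) - mean f * mean g =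
    mean (fun x => d x * g x) - mean d * mean g.
  have -> : mean d = mean f - c by rewrite meanB ?mean_cst//; auto with bounded_mfun.
  have -> : mean (fun x => d x * g x) = mean (fun x => f x * g x) - c * mean g.
    rewrite -meanZ// -meanB; [|by auto with bounded_mfun..].
    by apply: eq_mean => x _; rewrite mulrBl.
  by ring.
rewrite (le_trans (ler_normB _ _))// (_ : 2 * eps * M = eps * M + eps * M); last by ring.
rewrite lerD//.
  by apply: norm_mean_le_bound => [|x Ix]; [auto with bounded_mfun|rewrite normrM ler_pM ?fc ?gM].
by rewrite normrM ler_pM// norm_mean_le_bound.
Qed.

Lemma continuous_oscillation h eps : continuous h -> 0 < eps ->
  \forall n \near \oo, forall i x, (i < n.+1)%N -> unitI x ->
    `|h ((i%:R + x) / n.+1%:R) - h (i%:R / n.+1%:R)| <= eps.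
Proof.
move=> ch eps0; have eps20 : 0 < eps / 2 by rewrite divr_gt0.
have [k k0 hk] : exists2 k, 0 <= k &
    forall x y, unitI x -> unitI y -> `|h x - h y| <= eps / 2 + k * (x - y) ^+ 2.
  apply: (@compact_modulus _ _ _ h id); [exact: segment_compact|exact: ch| | |].
  - by move=> x; exact: cvg_id.
  - by move=> x y _ _ ->.
  - exact: eps20.
near=> n => i x lein; rewrite /unitI/= in_itv/= => /andP[x0 x1].
pose N : R := n.+1%:R; have N0 : 0 < N by rewrite ltr0n.
have kN : k / N <= eps / 2.
  rewrite ler_pdivrMr// mulrC -ler_pdivrMr// /N -[n.+1%:R]natr1 ler_wpDr//.
  by near: n; exact: nbhs_infty_ger.
have i0 : 0 <= i%:R :> R by []; have lein' : i%:R + 1 <= N by rewrite natr1 ler_nat.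
apply: le_trans (hk _ _ _ _) _.
- by rewrite /unitI/= in_itv/= ler_pdivrMr// divr_ge0 ?addr_ge0 ?(ltW N0)//=; lra.
- by rewrite /unitI/= in_itv/= ler_pdivrMr// divr_ge0 ?(ltW N0)//=; lra.
rewrite [leRHS]splitr lerD2l (le_trans _ kN)// ler_wpM2l//.
have -> : (i%:R + x) / N - i%:R / N = x / N by rewrite -mulrBl addrAC subrr add0r.
rewrite expr_div_n ler_pdivrMr ?exprn_gt0//.
have -> : N^-1 * N ^+ 2 = N by field; rewrite lt0r_neq0.
by rewrite (@le_trans _ _ 1) ?exprn_ile1// ler1n.
Unshelve. all: by end_near. Qed.

Lemma fejer_continuous h g : continuous h -> continuous g -> periodic g 1 ->
  mean (fun x => h x * g (n%:R * x)) @[n --> \oo] --> mean h * mean g.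
Proof.
move=> ch cg pg; have bg := continuous_bounded_mfun cg; have [_ [M gM]] := bg.
have M0 : 0 <= M by rewrite (le_trans (normr_ge0 _) (gM 0 _))// /unitI/= in_itv/= lexx ler01.
pose u n := mean (fun x => h x * g (n%:R * x)).
rewrite -(cvg_shiftS u); apply/cvgrPdist_le => eps eps0.
pose d := eps / (2 * (M + 1)).
have d0 : 0 < d by rewrite divr_gt0// mulr_gt0// ltr_wpDl.
near=> n; have osc : forall i x, (i < n.+1)%N -> unitI x ->
    `|h ((i%:R + x) / n.+1%:R) - h (i%:R / n.+1%:R)| <= d.
  by near: n; exact: continuous_oscillation.
pose N : R := n.+1%:R; have N0 : 0 < N by rewrite ltr0n.
pose hp i x := h ((i%:R + x) / N).
have bhp i : bounded_mfun (hp i).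
  apply: continuous_bounded_mfun => x; apply: continuous_comp; last exact: ch.
  by apply: cvgM; [apply: cvgD; [exact: cvg_cst|exact: cvg_id]|exact: cvg_cst].
have hE : mean h = N^-1 * \sum_(0 <= i < n.+1) mean (hp i) by exact: mean_dissect.
have uE : u n.+1 = N^-1 * \sum_(0 <= i < n.+1) mean (fun x => hp i x * g x).
  rewrite /u (@mean_dissect _ n); last first.
    move=> x; apply: cvgM; first exact: ch.
    by apply: continuous_comp; [apply: cvgM; [exact: cvg_cst|exact: cvg_id]|exact: cg].
  congr (_ * _); apply: eq_bigr => i _; apply: eq_mean => x _.
  rewrite /hp -/N [N * _]mulrC divfK ?lt0r_neq0// addrC; congr (_ * _).
  exact: (periodicn pg).
have -> : mean h * mean g - u n.+1 = - (N^-1 * \sum_(0 <= i < n.+1)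
    (mean (fun x => hp i x * g x) - mean (hp i) * mean g)).
  by rewrite uE hE sumrB -mulr_suml; ring.
rewrite normrN normrM gtr0_norm ?invr_gt0// ler_pdivrMl//.
apply: (le_trans (ler_norm_sum _ _ _)).
apply: (@le_trans _ _ (\sum_(0 <= i < n.+1) (2 * d * M))).
  rewrite big_nat [leRHS]big_nat; apply: ler_sum => i /andP[_ lein].
  by apply: (mean_mul_near_const (c := h (i%:R / N))) => // x; exact: osc.
rewrite sumr_const_nat subn0 -[leLHS]mulr_natl ler_wpM2l// /d.
have -> : 2 * (eps / (2 * (M + 1))) * M = eps * (M / (M + 1)).
  by field; rewrite gt_eqF// ltr_wpDl.
by rewrite ler_piMr ?(ltW eps0)// ler_pdivrMr ?ltr_wpDl// mul1r lerDl.
Unshelve. all: by end_near. Qed.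

Theorem fejer h g : bounded_mfun h -> continuous g -> periodic g 1 ->
  mean (fun x => h x * g (n%:R * x)) @[n --> \oo] --> mean h * mean g.
Proof.
move=> bh cg pg; have bg := continuous_bounded_mfun cg; have [_ [M gM]] := bg.
have M0 : 0 <= M by rewrite (le_trans (normr_ge0 _) (gM 0 _))// /unitI/= in_itv/= lexx ler01.
have gnM n x : unitI x -> `|g (n%:R * x)| <= M.
  rewrite /unitI/= in_itv/= => /andP[x0 _].
  have /truncn_itv : 0 <= n%:R * x by rewrite mulr_ge0.
  set m := Num.truncn _; rewrite -natr1 => nx.
  rewrite -(subrK m%:R (n%:R * x)) (periodicn pg) gM// /unitI/= in_itv/=; lra.
have bgn n : bounded_mfun (fun x => g (n%:R * x)).
  apply: continuous_bounded_mfun => x; apply: continuous_comp; last exact: cg.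
  by apply: cvgM; [exact: cvg_cst|exact: cvg_id].
apply/cvgrPdist_le => eps eps0.
pose d := eps / (2 * M + 1).
have d0 : 0 < d by rewrite divr_gt0// ltr_wpDl// mulr_ge0.
have [h' ch' hh'] := continuous_mean_approx bh d0.
have bh' := continuous_bounded_mfun ch'.
have near_h g' : bounded_mfun g' -> (forall x, unitI x -> `|g' x| <= M) ->
    `|mean (fun x => h x * g' x) - mean (fun x => h' x * g' x)| <= d * M.
  move=> bg' g'M; rewrite -meanB; [|by auto with bounded_mfun..].
  rewrite (le_trans (norm_mean_le _))//; first by auto with bounded_mfun.
  rewrite mulrC (le_trans _ (ler_wpM2l M0 (ltW hh')))// -meanZ; last by auto with bounded_mfun.
  apply: le_mean => [||x Ix]; [by auto with bounded_mfun..|].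
  by rewrite -mulrBl normrM mulrC ler_wpM2r ?g'M.
have /cvgrPdist_le/(_ _ d0) := fejer_continuous ch' cg pg.
apply: filterS => n hn.
have diff_g : `|mean h * mean g - mean h' * mean g| <= d * M.
  have meanE f : bounded_mfun f -> mean f * mean g = mean (fun x => f x * (fun=> mean g) x).
    by move=> bf; rewrite mulrC -meanZ//; apply: eq_mean => x _; rewrite mulrC.
  rewrite !meanE//; apply: near_h => [|x _]; first exact: bounded_mfun_cst.
  exact: norm_mean_le_bound.
have diff_gn := near_h _ (bgn n) (gnM n).
have -> : eps = d * M + d + d * M by rewrite /d; field; rewrite gt_eqF// ltr_wpDl// mulr_ge0.
set a := mean h * _ in diff_g *; set b := mean h' * _ in hn diff_g.
set u := mean _ in diff_gn *; set v := mean _ in diff_gn hn.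
have -> : a - u = (a - b) + (b - v) + (v - u) by ring.
rewrite (le_trans (ler_normD _ _))// lerD//; last by rewrite distrC.
by rewrite (le_trans (ler_normD _ _))// lerD.
Qed.

End Fejer.

Section BinomialFactor.
Context {R : realType}.
Implicit Types (b c s x d : R) (h : R -> R).

(* The squared modulus of 1 + c e(n x). *)
Definition binom_sqmod c (n : nat) x : R := 1 + (c ^+ 2 + 2 * c * ecos n x).

Lemma binom_sqmod_ge c n x : 0 <= c -> (1 - c) ^+ 2 <= binom_sqmod c n x.
Proof.
move=> c0; have := ecos_norm n x; rewrite ler_norml /binom_sqmod => /andP[x1 _].
by nra.
Qed.

Lemma binom_sqmod_ge0 c n x : 0 <= c -> 0 <= binom_sqmod c n x.
Proof. by move=> c0; rewrite (le_trans _ (binom_sqmod_ge n x c0))// sqr_ge0. Qed.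

Lemma binom_sqmod_gt0 c n x : 0 < c < 1 -> 0 < binom_sqmod c n x.
Proof.
move=> /andP[c0 c1]; rewrite (lt_le_trans _ (binom_sqmod_ge n x (ltW c0)))//.
by rewrite exprn_gt0// subr_gt0.
Qed.

Lemma continuous_binom_sqmod c n : continuous (binom_sqmod c n).
Proof.
move=> x; apply: cvgD; first exact: cvg_cst.
apply: cvgD; first exact: cvg_cst.
by apply: cvgMr; exact: continuous_ecos.
Qed.

Lemma bounded_mfun_binom_sqmod_powR c n s : 0 <= c -> 0 <= s ->
  bounded_mfun (fun x => binom_sqmod c n x `^ s).
Proof.
move=> c0 s0; apply: bounded_mfun_powR => // [x|]; first exact: binom_sqmod_ge0.
exact/continuous_bounded_mfun/continuous_binom_sqmod.
Qed.

Lemma binom_sqmod_natrM c n N x : binom_sqmod c n (N%:R * x) = binom_sqmod c (n * N) x.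
Proof. by rewrite /binom_sqmod ecos_natrM. Qed.

Lemma binom_sqmod_powR_tangent s : exists2 C, 0 < C & forall b n x, 0 <= b <= 8^-1 ->
  `|binom_sqmod b n x `^ s - (1 + 2 * s * b * ecos n x)| <= C * b ^+ 2.
Proof.
have [C C0 tangent] := powR_tangent_error s.
exists (9 * C + `|s|) => [|b n x]; first by rewrite ltr_pwDl// mulr_gt0.
rewrite -[8^-1]div1r => /andP[b0 b8]; set t := b ^+ 2 + 2 * b * ecos n x.
have t3 : `|t| <= 3 * b.
  by have := ecos_norm n x; rewrite /t !ler_norml => /andP[x1 x2]; nra.
have t2 : t ^+ 2 <= 9 * b ^+ 2.
  rewrite -(real_normK (num_real t)) (_ : 9 * b ^+ 2 = (3 * b) ^+ 2); last by ring.
  by rewrite lerXn2r ?nnegrE// mulr_ge0.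
have := tangent t; rewrite -div1r -/(binom_sqmod b n x) => /(_ _).
set U := _ `^ s => errt.
have -> : U - (1 + 2 * s * b * ecos n x) = (U - (1 + s * t)) + s * b ^+ 2.
  by rewrite /t; ring.
rewrite (le_trans (ler_normD _ _))// mulrDl lerD//.
  rewrite (le_trans (errt _))//; first by rewrite (le_trans t3)//; lra.
  by rewrite (mulrC 9) -mulrA ler_wpM2l// ltW.
by rewrite normrM (ger0_norm (sqr_ge0 b)).
Qed.

End BinomialFactor.

Section FourierCoefficients.
Context {R : realType} (c s : R) (c01 : 0 < c < 1) (s0 : 0 < s).
Implicit Types (x d e : R) (h : R -> R) (j k : nat).

Let c_ge0 : 0 <= c. Proof. by case/andP: c01 => /ltW. Qed.

Let W x := binom_sqmod c 1 x `^ s.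

Definition powR_coef k := mean (fun x => W x * ecos k x).

Lemma is_derive_binom_sqmod_powR x : is_derive x 1
  (fun y => binom_sqmod c 1 y `^ (s + 1))
  ((s + 1) * binom_sqmod c 1 x `^ s * (- (4 * pi * c) * esin 1 x)).
Proof.
rewrite (_ : (fun y => _) = (fun a => a `^ (s + 1)) \o binom_sqmod c 1)//.
have dn : is_derive x 1 (binom_sqmod c 1) (- (4 * pi * c) * esin 1 x).
  have := is_derive_ecos 1 x => dc.
  rewrite (_ : binom_sqmod c 1 = cst (1 + c ^+ 2) + (2 * c) \*: ecos 1); last first.
    by apply/funext => y; rewrite /binom_sqmod addrA.
  by apply: is_derive_eq; rewrite /GRing.scale/=; ring.
have := is_derive1_powR (s + 1) (binom_sqmod_gt0 1 x c01) => dpow.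
by apply: is_derive_eq; rewrite /GRing.scale/= addrK.
Qed.

Let continuous_W : continuous W.
Proof.
move=> x; apply: (@continuous_comp _ _ _ (binom_sqmod c 1) (fun a => a `^ s)).
  exact: continuous_binom_sqmod.
apply/differentiable_continuous/derivable1_diffP.
by have [] := is_derive1_powR s (binom_sqmod_gt0 1 x c01).
Qed.

Let continuous_W_ecos k : continuous (fun x => W x * ecos k x).
Proof. by move=> x; apply: cvgM; [exact: continuous_W|exact: continuous_ecos]. Qed.

Let continuous_W_esin k : continuous (fun x => W x * esin k x).
Proof. by move=> x; apply: cvgM; [exact: continuous_W|exact: continuous_esin]. Qed.

Let periodic_W_ecos k : periodic (fun x => W x * ecos k x) 1.
Proof. by move=> x; rewrite /W /binom_sqmod !ecos_periodic. Qed.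

Let periodic_W_esin k : periodic (fun x => W x * esin k x) 1.
Proof. by move=> x; rewrite /W /binom_sqmod ecos_periodic esin_periodic. Qed.

(* Integrate the derivative of sin(2 pi (j+1) x) |1 + c e(x)|^(2 s + 2) over a
   period. *)
Lemma powR_coef_recurrence j :
  j.+1%:R * (1 + c ^+ 2) * powR_coef j.+1 + c * (j.+2%:R + s) * powR_coef j.+2
  + c * (j%:R - s) * powR_coef j = 0.
Proof.
pose v k x := W x * ecos k x.
pose F x := esin j.+1 x * binom_sqmod c 1 x `^ (s + 1).
pose f x := 2 * pi * (j.+1%:R * (1 + c ^+ 2) * v j.+1 x +
  c * (j.+2%:R + s) * v j.+2 x + c * (j%:R - s) * v j x).
have cf : continuous f.
  move=> x; apply: cvgMr; apply: cvgD; last by apply: cvgMr; exact: continuous_W_ecos.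
  by apply: cvgD; apply: cvgMr; exact: continuous_W_ecos.
have dF x : is_derive x 1 F (f x).
  have := is_derive_esin j.+1 x => d1; have := is_derive_binom_sqmod_powR x => d2.
  apply: is_derive_eq; rewrite /GRing.scale/= /f /v /W.
  have -> : binom_sqmod c 1 x `^ (s + 1) = binom_sqmod c 1 x * binom_sqmod c 1 x `^ s.
    have W0 := binom_sqmod_gt0 1 x c01.
    by rewrite powRD ?(gt_eqF W0) ?implybT// powRr1 ?(ltW W0)// mulrC.
  have -> : ecos j x = ecos j.+1 x * ecos 1 x + esin j.+1 x * esin 1 x.
    by rewrite -ecosB// subn1.
  have -> : ecos j.+2 x = ecos j.+1 x * ecos 1 x - esin j.+1 x * esin 1 x.
    by rewrite -ecosD addn1.
  by rewrite {2}/binom_sqmod -!natr1; ring.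
have := mean_derive (fun x _ => dF x) cf; rewrite /F.
have esin1 : esin j.+1 1 = 0 :> R.
  by rewrite -[X in esin _ X]add0r esin_periodic /esin mulr0 sin0.
have -> : esin j.+1 0 = 0 :> R by rewrite /esin mulr0 sin0.
have bv k : bounded_mfun (v k) by exact/continuous_bounded_mfun/continuous_W_ecos.
rewrite esin1 !mul0r subrr /f meanZ; last by auto 10 with bounded_mfun.
have pi2 : 2 * pi != 0 :> R by rewrite gt_eqF// mulr_gt0// pi_gt0.
move=> /eqP; rewrite mulf_eq0 (negbTE pi2)/= => /eqP.
by do 2 (rewrite meanD; [|by auto 10 with bounded_mfun..]); rewrite !meanZ.
Qed.

Lemma powR_coef0_gt0 : 0 < powR_coef 0.
Proof.
have [c0 c1] := andP c01.
have c1s : 0 < (1 - c) ^+ 2 by rewrite exprn_gt0// subr_gt0.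
apply: (@lt_le_trans _ _ (((1 - c) ^+ 2) `^ s)); first by rewrite powR_gt0.
rewrite -[leLHS]mean_cst; apply: le_mean => [||x _]; first exact: bounded_mfun_cst.
  exact/continuous_bounded_mfun/continuous_W_ecos.
rewrite ecos0 mulr1 ge0_ler_powR ?nnegrE ?(ltW s0) ?(ltW c1s) ?binom_sqmod_ge0//.
exact: binom_sqmod_ge.
Qed.

Lemma powR_coef_succ_neq0 j : (forall n : nat, s != n%:R) ->
  powR_coef j != 0 \/ powR_coef j.+1 != 0.
Proof.
move=> sN; have c0 : c != 0 by rewrite gt_eqF//; case/andP: c01.
elim: j => [|j [h|h]]; first by left; rewrite gt_eqF// powR_coef0_gt0.
  have [h1|] := eqVneq (powR_coef j.+1) 0; [right|by left].
  apply/negP => /eqP h2; have /eqP := powR_coef_recurrence j.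
  rewrite h1 h2 !mulr0 !add0r !mulf_eq0 (negbTE c0) (negbTE h) orbF/=.
  by rewrite subr_eq0 eq_sym (negbTE (sN j)).
by left.
Qed.

(* For [j > s] the three coefficients of the recurrence are positive, so that
   three consecutive Fourier coefficients cannot have the same sign; they do not
   vanish simultaneously because [s] is not an integer. *)
Lemma powR_coef_signs (e : R) : (forall n : nat, s != n%:R) -> e != 0 ->
  exists2 k, (1 < k)%N & 0 < e * powR_coef k.
Proof.
move=> sN e0; apply: contrapT => none.
have e_le0 k : (1 < k)%N -> e * powR_coef k <= 0.
  by move=> k1; rewrite leNgt; apply/negP => ek; apply: none; exists k.
pose j := (Num.bound s).+2; have [c0 c1] := andP c01.
have js : 0 < j%:R - s.
  by rewrite subr_gt0 (lt_le_trans (archi_boundP (ltW s0)))// ler_nat /j -addn2 leq_addr.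
have x0 : e * powR_coef j <= 0 := e_le0 j isT.
have y0 : e * powR_coef j.+1 <= 0 := e_le0 j.+1 isT.
have z0 : e * powR_coef j.+2 <= 0 := e_le0 j.+2 isT.
have A0 : 0 < j.+1%:R * (1 + c ^+ 2) by rewrite mulr_gt0 ?ltr0n// ltr_pwDl ?sqr_ge0.
have B0 : 0 < c * (j.+2%:R + s) by rewrite mulr_gt0// ltr_pwDl ?ltr0n// ltW.
have C0 : 0 < c * (j%:R - s) by rewrite mulr_gt0.
have Ay := mulr_ge0_le0 (ltW A0) y0; have Bz := mulr_ge0_le0 (ltW B0) z0.
have Cx := mulr_ge0_le0 (ltW C0) x0.
have rec : j.+1%:R * (1 + c ^+ 2) * (e * powR_coef j.+1) +
    c * (j.+2%:R + s) * (e * powR_coef j.+2) + c * (j%:R - s) * (e * powR_coef j) = 0.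
  by rewrite -[RHS](mulr0 e) -(powR_coef_recurrence j); ring.
have zero k t : e * powR_coef k <= 0 -> 0 < t -> 0 <= t * (e * powR_coef k) -> powR_coef k = 0.
  move=> ek t0; rewrite pmulr_rge0// => ke; apply: (mulfI e0).
  by rewrite mulr0; apply/eqP; rewrite eq_le ek.
case: (powR_coef_succ_neq0 j sN) => /eqP; apply.
- by apply: (zero _ _ x0 C0); lra.
- by apply: (zero _ _ y0 A0); lra.
Qed.

Lemma mean_binom_sqmod_powR_esin k : mean (fun x => W x * esin k x) = 0.
Proof.
apply: mean_antisymmetric => [|x]; first exact/continuous_bounded_mfun/continuous_W_esin.
by rewrite /W /binom_sqmod ecos_onem esin_onem mulrN.
Qed.

(* Fejer's lemma decouples the frequencies [m] and [k N], so that a factor of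
   frequency [m + k N] is seen through its [k]-th Fourier coefficient. *)
Lemma two_frequency_limit (a d : R) (m k : nat) h : bounded_mfun h ->
  mean (fun x => h x * (binom_sqmod c N x `^ s * (a + d * ecos (m + k * N) x)))
    @[N --> \oo] -->
  powR_coef 0 * mean (fun x => h x * (a + d * (powR_coef k / powR_coef 0) * ecos m x)).
Proof.
move=> bh; have f0 : powR_coef 0 != 0 by rewrite gt_eqF// powR_coef0_gt0.
have bhc : bounded_mfun (fun x => h x * ecos m x) by auto with bounded_mfun.
have bhs : bounded_mfun (fun x => h x * esin m x) by auto with bounded_mfun.
have L0 := fejer bh (@continuous_W_ecos 0) (@periodic_W_ecos 0).
have Lc := fejer bhc (@continuous_W_ecos k) (@periodic_W_ecos k).
have Ls := fejer bhs (@continuous_W_esin k) (@periodic_W_esin k).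
rewrite mean_binom_sqmod_powR_esin mulr0 in Ls.
have -> : powR_coef 0 * mean (fun x => h x * (a + d * (powR_coef k / powR_coef 0) * ecos m x)) =
    a * (mean h * powR_coef 0) + d * (mean (fun x => h x * ecos m x) * powR_coef k - 0).
  transitivity (powR_coef 0 * (a * mean h +
      (d * (powR_coef k / powR_coef 0)) * mean (fun x => h x * ecos m x))).
    congr (_ * _); rewrite -!meanZ// -meanD; [|by auto with bounded_mfun..].
    by congr mean; apply/funext => x; ring.
  by field.
rewrite [X in X @ _](_ : _ = fun N =>
   a * mean (fun x => h x * (W (N%:R * x) * ecos 0 (N%:R * x))) + d *
   (mean (fun x => h x * ecos m x * (W (N%:R * x) * ecos k (N%:R * x))) -
    mean (fun x => h x * esin m x * (W (N%:R * x) * esin k (N%:R * x))))).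
  by apply: cvgD; apply: cvgMr => //; exact: cvgB.
apply/funext => N.
have bW : bounded_mfun (fun x => W (N%:R * x)).
  rewrite /W; under eq_fun do rewrite binom_sqmod_natrM.
  exact: bounded_mfun_binom_sqmod_powR (ltW s0).
have bc j : bounded_mfun (fun x => ecos j (N%:R * x)).
  by under eq_fun do rewrite ecos_natrM; exact: bounded_mfun_ecos.
have bs j : bounded_mfun (fun x => esin j (N%:R * x)).
  by under eq_fun do rewrite esin_natrM; exact: bounded_mfun_esin.
rewrite -meanB -?meanZ -?meanD; [|by auto 10 with bounded_mfun..].
congr mean; apply/funext => x; rewrite /W binom_sqmod_natrM mul1n ecos0 mulr1.
by rewrite ecosD -ecos_natrM -esin_natrM; ring.
Qed.

End FourierCoefficients.

Section TrigonometricPolynomials.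
Context {R : realType}.
Implicit Types (P Q : {poly R}) (F : nat -> R) (c s x : R) (n G : nat).

Definition coef_sum F P := \sum_(0 <= i < size P) P`_i * F i.

Lemma coef_sum_widen F P n : (size P <= n)%N ->
  coef_sum F P = \sum_(0 <= i < n) P`_i * F i.
Proof.
move=> Pn; rewrite [RHS](big_cat_nat (n := size P))//=.
rewrite [X in _ = _ + X]big_nat [X in _ = _ + X]big1 ?addr0// => i /andP[Pi _].
by rewrite nth_default ?mul0r.
Qed.

Lemma coef_sumMXn F P n : coef_sum F (P * 'X^n) = coef_sum (fun i => F (i + n)%N) P.
Proof.
rewrite (coef_sum_widen _ (n := n + size P)); last first.
  by rewrite (leq_trans (size_polyMleq _ _))// size_polyXn addnS addnC.
rewrite (big_cat_nat (n := n)) ?leq_addr//= [X in X + _]big_nat big1 ?add0r; last first.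
  by move=> i /andP[_ lin]; rewrite coefMXn lin mul0r.
rewrite -{1}[n]add0n big_addn addKn; apply: eq_bigr => i _.
by rewrite coefMXn ltnNge leq_addl/= addnK.
Qed.

Lemma coef_sumDZ F P Q c : coef_sum F (P + c *: Q) = coef_sum F P + c * coef_sum F Q.
Proof.
pose n := maxn (size P) (size Q).
rewrite (coef_sum_widen _ (n := n)); last first.
  rewrite (leq_trans (size_polyD _ _))// geq_max leq_maxl.
  by rewrite (leq_trans (size_scale_leq _ _))// leq_maxr.
rewrite (coef_sum_widen F (leq_maxl _ _ : size P <= n)%N).
rewrite (coef_sum_widen F (leq_maxr _ _ : size Q <= n)%N).
rewrite mulr_sumr -big_split/=; apply: eq_bigr => i _.
by rewrite coefD coefZ mulrDl mulrA.
Qed.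

Lemma coef_sumZ F P c : coef_sum F (c *: P) = c * coef_sum F P.
Proof.
by rewrite -[c *: P]add0r coef_sumDZ {1}/coef_sum size_poly0 big_nil add0r.
Qed.

Definition poly_re P x := coef_sum (ecos^~ x) P.
Definition poly_im P x := coef_sum (esin^~ x) P.

Definition sqmod P x := poly_re P x ^+ 2 + poly_im P x ^+ 2.

Lemma poly_reMXn P n x :
  poly_re (P * 'X^n) x = poly_re P x * ecos n x - poly_im P x * esin n x.
Proof.
rewrite /poly_re /poly_im coef_sumMXn !mulr_suml -sumrB; apply: eq_bigr => i _.
by rewrite ecosD; ring.
Qed.

Lemma poly_imMXn P n x :
  poly_im (P * 'X^n) x = poly_im P x * ecos n x + poly_re P x * esin n x.
Proof.
rewrite /poly_re /poly_im coef_sumMXn !mulr_suml -big_split/=; apply: eq_bigr => i _.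
by rewrite esinD; ring.
Qed.

Lemma sqmod_ge0 P x : 0 <= sqmod P x.
Proof. by rewrite addr_ge0 ?sqr_ge0. Qed.

Lemma sqmod1 x : sqmod 1 x = 1.
Proof.
rewrite /sqmod /poly_re /poly_im /coef_sum size_poly1 !big_nat1 coef1/=.
by rewrite ecos0 esin0; ring.
Qed.

Lemma sqmodZ P c x : sqmod (c *: P) x = c ^+ 2 * sqmod P x.
Proof. by rewrite /sqmod /poly_re /poly_im !coef_sumZ; ring. Qed.

Lemma sqmodMXn P n x : sqmod (P * 'X^n) x = sqmod P x.
Proof.
rewrite /sqmod poly_reMXn poly_imMXn; have := ecos2Desin2 n x.
set a := poly_re P x; set b := poly_im P x; set C := ecos n x; set S := esin n x => CS.
by transitivity ((a ^+ 2 + b ^+ 2) * (C ^+ 2 + S ^+ 2)); [ring|rewrite CS mulr1].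
Qed.

Lemma bounded_mfun_coef_sum (F : nat -> R -> R) P : (forall i, bounded_mfun (F i)) ->
  bounded_mfun (fun x => coef_sum (F^~ x) P).
Proof.
move=> bF; rewrite /coef_sum; elim: (size P) => [|n ih].
  by under eq_fun do rewrite big_nil; exact: bounded_mfun_cst.
by under eq_fun do rewrite big_nat_recr//=; auto with bounded_mfun.
Qed.

Lemma bounded_mfun_sqmod P : bounded_mfun (sqmod P).
Proof.
have bre : bounded_mfun (poly_re P) by exact/bounded_mfun_coef_sum/bounded_mfun_ecos.
have bim : bounded_mfun (poly_im P) by exact/bounded_mfun_coef_sum/bounded_mfun_esin.
rewrite (_ : sqmod P = fun x => poly_re P x * poly_re P x + poly_im P x * poly_im P x).
  by auto with bounded_mfun.
by apply/funext => x; rewrite /sqmod !expr2.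
Qed.

Lemma bounded_mfun_sqmod_powR P s : 0 <= s -> bounded_mfun (fun x => sqmod P x `^ s).
Proof.
by move=> s0; apply: bounded_mfun_powR => //; [exact: sqmod_ge0|exact: bounded_mfun_sqmod].
Qed.

Definition mul_binom P c n := P + c *: (P * 'X^n).

Lemma sqmod_mul_binom P c n x :
  sqmod (mul_binom P c n) x = sqmod P x * binom_sqmod c n x.
Proof.
rewrite /sqmod /poly_re /poly_im !coef_sumDZ -/(poly_re P x) -/(poly_im P x).
rewrite -/(poly_re (P * 'X^n) x) -/(poly_im (P * 'X^n) x) poly_reMXn poly_imMXn.
rewrite /binom_sqmod; have := ecos2Desin2 n x.
set a := poly_re P x; set b := poly_im P x; set C := ecos n x; set S := esin n x => CS.
transitivity ((a ^+ 2 + b ^+ 2) *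
  (1 + (c ^+ 2 * (C ^+ 2 + S ^+ 2) + 2 * c * C))); first by ring.
by rewrite CS mulr1.
Qed.

Lemma size_mul_binom P c n : (size (mul_binom P c n) <= size P + n)%N.
Proof.
rewrite (leq_trans (size_polyD _ _))// geq_max leq_addr/=.
rewrite (leq_trans (size_scale_leq _ _))// (leq_trans (size_polyMleq _ _))//.
by rewrite size_polyXn addnS.
Qed.

Definition gapped G P := [/\ forall i, 0 <= P`_i, 0 < P`_0 &
  forall i j, (i < j)%N -> P`_i != 0 -> P`_j != 0 -> (G <= j - i)%N].

Lemma gapped1 G : gapped G 1.
Proof.
split=> [i||i j ij _]; rewrite coef1.
- by rewrite ler0n.
- by rewrite ltr01.
- by rewrite gtn_eqF ?eqxx// (leq_ltn_trans _ ij).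
Qed.

Lemma gappedZ G P c : 0 < c -> gapped G P -> gapped G (c *: P).
Proof.
move=> c0 [P0 P00 gP]; split=> [i||i j ij]; rewrite ?coefZ.
- by rewrite mulr_ge0// ltW.
- exact: mulr_gt0.
- by rewrite !mulf_eq0 !negb_or => /andP[_ Pi] /andP[_ Pj]; exact: gP.
Qed.

Lemma gapped_mul_binom G P c n : 0 <= c -> (size P + G <= n)%N -> (0 < n)%N ->
  gapped G P -> gapped G (mul_binom P c n).
Proof.
move=> c0 Pn n0 [P0 P00 gP].
have coefE i : (mul_binom P c n)`_i = P`_i + c * (if (i < n)%N then 0 else P`_(i - n)).
  by rewrite coefD coefZ coefMXn.
have nz i : (mul_binom P c n)`_i != 0 ->
    (P`_i != 0 /\ (i < size P)%N) \/ ((n <= i)%N /\ P`_(i - n) != 0).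
  rewrite coefE; have [lin|nlei] := ltnP i n.
    rewrite mulr0 addr0 => Pi; left; split => //.
    by rewrite ltnNge; apply: contra Pi => Pi; rewrite nth_default.
  rewrite nth_default ?add0r; last by rewrite (leq_trans _ nlei)// (leq_trans _ Pn)// leq_addr.
  by rewrite mulf_eq0 negb_or => /andP[_ Pi]; right.
split=> [i||i j ij].
- by rewrite coefE; case: ltnP => _; rewrite ?mulr0 ?addr0// addr_ge0// mulr_ge0.
- by rewrite coefE n0 mulr0 addr0.
- move=> /nz[[Pi iP]|[ni Pi]] /nz[[Pj jP]|[nj Pj]].
  + exact: gP.
  + by lia.
  + by lia.
  + have := gP (i - n)%N (j - n)%N; rewrite ltn_sub2r//; last by rewrite (leq_ltn_trans ni).
    by move=> /(_ isT Pi Pj); lia.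
Qed.

Lemma gapped_mul_binom2 G P c b m k N : 0 <= c -> 0 <= b -> (size P + G < N)%N ->
  (1 < k)%N -> gapped G P -> gapped G (mul_binom (mul_binom P c N) b (m + k * N)).
Proof.
move=> c0 b0 PN k1 gP.
have k2N : (N + N <= k * N)%N by rewrite addnn -mul2n leq_mul2r k1 orbT.
have szN : (size (mul_binom P c N) + G <= m + k * N)%N.
  by rewrite (leq_trans (leq_add (size_mul_binom _ _ _) (leqnn G)))//; clear - PN k2N; lia.
apply: gapped_mul_binom b0 szN _ _; first by clear - PN k2N; lia.
by apply: gapped_mul_binom c0 _ _ gP; clear - PN; lia.
Qed.

End TrigonometricPolynomials.

Section Outweighing.
Context {R : realType}.
Implicit Types (P : {poly R}) (b d x : R) (psi f w : R -> R).

Definition weight psi := bounded_mfun psi /\ forall x, 0 <= psi x.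

Lemma weight_indic A : measurable A -> weight (\1_A : R -> R).
Proof.
by move=> mA; split=> [|x]; [exact: bounded_mfun_indic|rewrite indicE].
Qed.

Lemma weightZ c psi : 0 <= c -> weight psi -> weight (fun x => c * psi x).
Proof.
by move=> c0 [bpsi psi0]; split=> [|x]; [auto with bounded_mfun|rewrite mulr_ge0].
Qed.

Lemma weight_expR psi f : weight psi -> bounded_mfun f ->
  weight (fun x => psi x * expR (f x)).
Proof.
by move=> [bpsi psi0] bf; split=> [|x]; [auto with bounded_mfun|rewrite mulr_ge0 ?expR_ge0].
Qed.

Variable s : R.

Definition outweighed psi1 psi2 := forall G, exists2 P, gapped G P &
  mean (fun x => psi1 x * sqmod P x `^ s) < mean (fun x => psi2 x * sqmod P x `^ s).

Lemma outweighed_lt_mean psi1 psi2 : mean psi1 < mean psi2 -> outweighed psi1 psi2.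
Proof.
move=> lt12 G; exists 1; first exact: gapped1.
have meanE psi : mean (fun x => psi x * sqmod 1 x `^ s) = mean psi.
  by apply: eq_mean => x _; rewrite sqmod1 powR1 mulr1.
by rewrite !meanE.
Qed.

Hypothesis s_gt0 : 0 < s.

Lemma outweighed_mono psi1 psi2 psi1' psi2' :
  bounded_mfun psi1 -> bounded_mfun psi2 -> bounded_mfun psi1' -> bounded_mfun psi2' ->
  (forall x, unitI x -> psi1 x <= psi1' x) -> (forall x, unitI x -> psi2' x <= psi2 x) ->
  outweighed psi1' psi2' -> outweighed psi1 psi2.
Proof.
move=> b1 b2 b1' b2' le1 le2 out G; have [P gP lt12] := out G; exists P => //.
have bP := bounded_mfun_sqmod_powR P (ltW s_gt0).
apply: le_lt_trans (lt_le_trans lt12 _); apply: le_mean => [||x Ix];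
  by [exact: bounded_mfunM|rewrite ler_wpM2r ?powR_ge0 ?le1 ?le2].
Qed.

Lemma exists_lt_cvg (u v : nat -> R) (lu lv : R) n0 :
  u @ \oo --> lu -> v @ \oo --> lv -> lu < lv -> exists2 n, (n0 <= n)%N & u n < v n.
Proof.
move=> cu cv uv; pose c := (lu + lv) / 2.
have nu : \forall n \near \oo, u n < c by apply: cvgr_lt cu _ _; rewrite /c; lra.
have nv : \forall n \near \oo, c < v n by apply: cvgr_gt cv _ _; rewrite /c; lra.
have [n [n0n un vn]] : exists n, [/\ (n0 <= n)%N, u n < c & c < v n].
  apply: (@filter_ex _ \oo); near=> n; split; near: n => //.
  exact: nbhs_infty_ge.
by exists n => //; exact: lt_trans un vn.
Unshelve. all: by end_near. Qed.

(* In terms of the Fourier coefficients a_k of |1 + e(x) / 2|^(2 s), the factor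
   (1 + z^N / 2) (1 + b z^(m + k N)) has, for large N, the effect of multiplying
   |P|^(2 s) by a constant times 1 + b (2 s a_k / a_0) cos(2 pi m x) + O(b^2). *)
Definition tilt_rate k := 2 * s * (powR_coef 2^-1 s k / powR_coef 2^-1 s 0).

Lemma outweighed_two_factors k : (1 < k)%N -> exists2 C, 0 < C & forall b m psi1 psi2,
  0 <= b <= 8^-1 -> weight psi1 -> weight psi2 ->
  outweighed (fun x => psi1 x * (1 + C * b ^+ 2 + tilt_rate k * b * ecos m x))
             (fun x => psi2 x * (1 - C * b ^+ 2 + tilt_rate k * b * ecos m x)) ->
  outweighed psi1 psi2.
Proof.
move=> k1; have [C C0 tangent] := @binom_sqmod_powR_tangent R s.
exists C => // b m psi1 psi2 b8 [b1 psi10] [b2 psi20] out G.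
have [P gP lt12] := out G; have /andP[b0 _] := b8.
have half0 : 0 <= (2^-1 : R) by rewrite invr_ge0.
have half01 : 0 < (2^-1 : R) < 1 by rewrite invr_gt0 ltr0n invf_lt1 ?ltr1n.
pose H x := sqmod P x `^ s; pose B c n x := binom_sqmod c n x `^ s.
have bH : bounded_mfun H := bounded_mfun_sqmod_powR P (ltW s_gt0).
have bB c n : 0 <= c -> bounded_mfun (B c n).
  by move=> c0; exact: bounded_mfun_binom_sqmod_powR (ltW s_gt0).
have rateE : tilt_rate k * b = 2 * s * b * (powR_coef 2^-1 s k / powR_coef 2^-1 s 0).
  by rewrite /tilt_rate; ring.
rewrite rateE in lt12.
have L1 := two_frequency_limit (a := 1 + C * b ^+ 2) (d := 2 * s * b) (m := m) (k := k)
  half01 s_gt0 (bounded_mfunM b1 bH).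
have L2 := two_frequency_limit (a := 1 - C * b ^+ 2) (d := 2 * s * b) (m := m) (k := k)
  half01 s_gt0 (bounded_mfunM b2 bH).
have [|N NP ltN] := exists_lt_cvg (size P + G).+1 L1 L2.
  rewrite ltr_pM2l ?powR_coef0_gt0//.
  by under eq_mean do rewrite mulrAC; under [ltRHS]eq_mean do rewrite mulrAC.
exists (mul_binom (mul_binom P 2^-1 N) b (m + k * N)); first exact: gapped_mul_binom2.
have HE x : sqmod (mul_binom (mul_binom P 2^-1 N) b (m + k * N)) x `^ s =
    H x * B 2^-1 N x * B b (m + k * N)%N x.
  by rewrite !sqmod_mul_binom !powRM ?mulr_ge0 ?binom_sqmod_ge0 ?sqmod_ge0.
under eq_mean do rewrite HE; under [ltRHS]eq_mean do rewrite HE.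
have bBh := bB _ N half0; have bBb := bB _ (m + k * N)%N b0.
apply: (le_lt_trans _ (lt_le_trans ltN _)); apply: le_mean => [||x _];
  try by auto 10 with bounded_mfun.
- rewrite 2!(mulrA (psi1 x)) (mulrA (psi1 x * H x)) ler_wpM2l ?mulr_ge0 ?powR_ge0//.
  by have := tangent b (m + k * N)%N x b8; rewrite ler_norml /B; clear; lra.
- rewrite 2!(mulrA (psi2 x) _ _) (mulrA (psi2 x * H x)) ler_wpM2l ?mulr_ge0 ?powR_ge0//.
  by have := tangent b (m + k * N)%N x b8; rewrite ler_norml /B; clear; lra.
Qed.

End Outweighing.

Section Tilting.
Context {R : realType} (s : R) (s_gt0 : 0 < s).
Implicit Types (P : {poly R}) (beta d u x : R) (psi T w : R -> R) (k m n : nat).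

Lemma expR_sub_sqr_le u : - 2^-1 <= u -> expR (u - 2 * u ^+ 2) <= 1 + u.
Proof.
rewrite -div1r => u2; have u0 : 0 < 1 - u + 2 * u ^+ 2 by nra.
rewrite -[leLHS]invrK -expRN.
apply: (@le_trans _ _ (1 - u + 2 * u ^+ 2)^-1).
  rewrite lef_pV2 ?posrE ?expR_gt0//.
  by apply: le_trans (expR_ge1Dx _); lra.
rewrite -[leLHS]mul1r ler_pdivrMr//.
have : 0 <= u ^+ 2 * (1 + 2 * u) by rewrite mulr_ge0 ?sqr_ge0//; lra.
by clear; lra.
Qed.

Lemma expR_sub_le u d : `|u| <= 4^-1 -> 0 <= d <= 4^-1 ->
  expR (u - (4 * u ^+ 2 + 2 * d)) <= 1 + u - d.
Proof.
rewrite -[4^-1]div1r ler_norml => /andP[u1 u2] /andP[d0 d1].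
rewrite -[leRHS]addrA; apply: le_trans (expR_sub_sqr_le _); last by rewrite -div1r; lra.
have d2 : 4 * d ^+ 2 <= d by nra.
by rewrite ler_expR; have := sqr_ge0 (u + d); clear - d2; lra.
Qed.

Lemma outweighed_small_tilt k : (1 < k)%N ->
  exists C b0, [/\ 0 < C, 0 < b0 & forall b m psi1 psi2,
    0 <= b <= b0 -> weight psi1 -> weight psi2 ->
    outweighed s (fun x => psi1 x * expR (tilt_rate s k * b * ecos m x + C * b ^+ 2))
                 (fun x => psi2 x * expR (tilt_rate s k * b * ecos m x - C * b ^+ 2)) ->
    outweighed s psi1 psi2].
Proof.
move=> k1; have [C C0 two_factors] := outweighed_two_factors s_gt0 k1.
move: (tilt_rate s k) two_factors => K two_factors.
pose C' := 4 * K ^+ 2 + 2 * C; have C'0 : 0 < C'.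
  by rewrite /C'; have := sqr_ge0 K; clear - C0; lra.
pose b0 := Num.min 8^-1 (Num.min (4^-1 / (`|K| + 1)) (4^-1 / (C + 1))).
have K1 : 0 < `|K| + 1 by rewrite ltr_wpDl.
have C1 : 0 < C + 1 by rewrite addr_gt0.
have inv4 : 0 < 4^-1 :> R by rewrite invr_gt0.
exists C', b0; split=> //; first by rewrite !lt_min invr_gt0 ltr0n !divr_gt0.
move=> b m psi1 psi2; rewrite !le_min !ler_pdivlMr// => /andP[b_ge0 /and3P[b8 bK bC]].
move=> wpsi1 wpsi2 out; have [[b1 psi10] [b2 psi20]] := (wpsi1, wpsi2).
have Cb : 0 <= C * b ^+ 2 <= 4^-1.
  have b1_le : b <= 1 by move: b8; rewrite -div1r; clear; lra.
  have Cb_ge0 : 0 <= C * b by rewrite mulr_ge0// ltW.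
  rewrite expr2 mulrA mulr_ge0//= (le_trans (ler_piMr Cb_ge0 b1_le))//.
  by apply: le_trans bC; rewrite mulrDr mulr1 mulrC lerDl.
have Kb x : `|K * b * ecos m x| <= 4^-1.
  rewrite !normrM (ger0_norm b_ge0) (le_trans _ bK)//.
  apply: (@le_trans _ _ (`|K| * b)); first by rewrite ler_piMr ?mulr_ge0 ?ecos_norm.
  by rewrite mulrDr mulr1 mulrC lerDl.
have cos2 x : (K * b * ecos m x) ^+ 2 <= K ^+ 2 * b ^+ 2.
  rewrite -exprMn [leLHS]exprMn ler_piMr ?sqr_ge0// -(real_normK (num_real (ecos m x))).
  by rewrite exprn_ile1// ecos_norm.
have b_b0 : 0 <= b <= 8^-1 by rewrite b_ge0.
apply: (two_factors b m) => //; move: out; apply: outweighed_mono => //;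
  try by auto 10 with bounded_mfun.
- move=> x _; rewrite ler_wpM2l//.
  apply: (@le_trans _ _ (expR (K * b * ecos m x + C * b ^+ 2))).
    by apply: le_trans (expR_ge1Dx _); rewrite addrAC addrA.
  rewrite ler_expR lerD2l /C'; have := sqr_ge0 (K * b); move: Cb => /andP[Cb0 _].
  by clear - Cb0; lra.
- move=> x _; rewrite ler_wpM2l// [leRHS]addrAC.
  apply: le_trans (expR_sub_le (Kb x) Cb); rewrite ler_expR lerD2l lerN2 /C'.
  by have := cos2 x; clear; lra.
Qed.

Lemma outweighed_iter w1 w2 n : bounded_mfun w1 -> bounded_mfun w2 ->
  (forall psi1 psi2, weight psi1 -> weight psi2 ->
    outweighed s (fun x => psi1 x * expR (w1 x)) (fun x => psi2 x * expR (w2 x)) ->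
    outweighed s psi1 psi2) ->
  forall psi1 psi2, weight psi1 -> weight psi2 ->
    outweighed s (fun x => psi1 x * expR (n%:R * w1 x))
                 (fun x => psi2 x * expR (n%:R * w2 x)) ->
    outweighed s psi1 psi2.
Proof.
move=> bw1 bw2 step; elim: n => [|n ih] psi1 psi2 wpsi1 wpsi2.
  under eq_fun do rewrite mul0r expR0 mulr1.
  by under [X in outweighed _ _ X]eq_fun do rewrite mul0r expR0 mulr1.
under eq_fun do rewrite mulrS mulrDl mul1r expRD mulrA.
under [X in outweighed _ _ X]eq_fun do rewrite mulrS mulrDl mul1r expRD mulrA.
by move=> /(ih _ _ (weight_expR wpsi1 bw1) (weight_expR wpsi2 bw2)); exact: step.
Qed.

Definition tiltable T := bounded_mfun T /\ forall d psi1 psi2, 0 < d ->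
  weight psi1 -> weight psi2 ->
  outweighed s (fun x => psi1 x * expR (T x + d)) (fun x => psi2 x * expR (T x - d)) ->
  outweighed s psi1 psi2.

Lemma tiltable0 : tiltable (fun=> 0).
Proof.
split=> [|d psi1 psi2 d0 [b1 psi10] [b2 psi20]]; first exact: bounded_mfun_cst.
apply: outweighed_mono => //; try by auto 10 with bounded_mfun.
- by move=> x _; rewrite add0r ler_peMr// -expR0 ler_expR ltW.
- by move=> x _; rewrite sub0r ler_piMr// -expR0 ler_expR oppr_le0 ltW.
Qed.

Lemma tiltableD T1 T2 : tiltable T1 -> tiltable T2 -> tiltable (fun x => T1 x + T2 x).
Proof.
move=> [bT1 tilt1] [bT2 tilt2]; split=> [|d psi1 psi2 d0 wpsi1 wpsi2 out].
  by auto with bounded_mfun.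
have d2 : 0 < d / 2 by rewrite divr_gt0.
apply: (tilt1 _ _ _ d2 wpsi1 wpsi2); apply: (tilt2 _ _ _ d2).
- by apply: weight_expR => //; auto with bounded_mfun.
- by apply: weight_expR => //; auto with bounded_mfun.
rewrite (_ : (fun x => _) = fun x => psi1 x * expR (T1 x + T2 x + d)); last first.
  by apply/funext => x; rewrite -mulrA -expRD; congr (_ * expR _); field.
rewrite (_ : (fun x => _ * expR (T2 x - _)) = fun x => psi2 x * expR (T1 x + T2 x - d))//.
by apply/funext => x; rewrite -mulrA -expRD; congr (_ * expR _); field.
Qed.

Lemma tiltable_sum n (T_ : nat -> R -> R) : (forall i, tiltable (T_ i)) ->
  tiltable (fun x => \sum_(0 <= i < n) T_ i x).
Proof.
move=> tT; elim: n => [|n ih].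
  by under eq_fun do rewrite big_nil; exact: tiltable0.
by under eq_fun do rewrite big_nat_recr//=; exact: tiltableD.
Qed.

Lemma tiltable_uniform T : bounded_mfun T -> (forall eps, 0 < eps ->
    exists2 T', tiltable T' & forall x, unitI x -> `|T x - T' x| <= eps) ->
  tiltable T.
Proof.
move=> bT approx; split=> // d psi1 psi2 d0 wpsi1 wpsi2 out.
have d2 : 0 < d / 2 by rewrite divr_gt0.
have [T' [bT' tilt'] TT'] := approx _ d2; have [[b1 psi10] [b2 psi20]] := (wpsi1, wpsi2).
apply: (tilt' _ _ _ d2 wpsi1 wpsi2); move: out; apply: outweighed_mono => //;
  try by auto 10 with bounded_mfun.
- by move=> x /TT'; rewrite ler_norml => TT'x; rewrite ler_wpM2l// ler_expR; lra.
- by move=> x /TT'; rewrite ler_norml => TT'x; rewrite ler_wpM2l// ler_expR; lra.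
Qed.

Hypothesis s_nat : forall n : nat, s != n%:R.

Lemma tiltable_ecos (g : R) m : tiltable (fun x => g * ecos m x).
Proof.
have [->|g0] := eqVneq g 0; first by under eq_fun do rewrite mul0r; exact: tiltable0.
split=> [|d psi1 psi2 d0 wpsi1 wpsi2 out]; first by auto with bounded_mfun.
have half01 : 0 < (2^-1 : R) < 1 by rewrite invr_gt0 ltr0n invf_lt1 ?ltr1n.
have [k k1 gk] := powR_coef_signs half01 s_gt0 s_nat g0.
have gK : 0 < g / tilt_rate s k.
  rewrite -sgr_gt0 sgrM sgrV -sgrM sgr_gt0 /tilt_rate mulrCA pmulr_rgt0; last exact: mulr_gt0.
  by rewrite mulrA divr_gt0// powR_coef0_gt0.
have K0 : tilt_rate s k != 0 by apply: contraTneq gK => ->; rewrite invr0 mulr0 ltxx.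
set K := tilt_rate s k in gK K0.
have [C [b0 [C0 b00 tilt]]] := outweighed_small_tilt k1.
have [n [n0 nb nd]] : exists n : nat, [/\ 0 < n%:R :> R, g / K / n%:R <= b0 &
    C * (g / K) ^+ 2 / n%:R <= d].
  apply: (@filter_ex _ \oo); near=> n.
  have n0 : 0 < n%:R :> R by near: n; exact: nbhs_infty_gtr.
  split=> //; rewrite ler_pdivrMr// -ler_pdivrMl//; near: n; exact: nbhs_infty_ger.
have n0' : n%:R != 0 :> R by rewrite gt_eqF.
pose b := g / K / n%:R; pose w (e x : R) := K * b * ecos m x + e * (C * b ^+ 2).
have nwE e x : n%:R * w e x = g * ecos m x + e * (C * (g / K) ^+ 2 / n%:R).
  by rewrite /w /b; field; rewrite K0 n0'.
have bw e : bounded_mfun (w e) by rewrite /w; auto with bounded_mfun.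
apply: (outweighed_iter (n := n) (bw 1) (bw (- 1)) _ wpsi1 wpsi2).
  move=> phi1 phi2; rewrite /w mulN1r mul1r; apply: tilt.
  by rewrite nb divr_ge0// ltW.
have [[b1 psi10] [b2 psi20]] := (wpsi1, wpsi2).
move: out; apply: outweighed_mono => //; try by auto 10 with bounded_mfun.
- by move=> x _; rewrite ler_wpM2l// ler_expR nwE mul1r lerD2l.
- by move=> x _; rewrite ler_wpM2l// ler_expR nwE mulN1r lerD2l lerN2.
Unshelve. all: by end_near. Qed.

Lemma tiltable_ecos1X_ecos (g : R) n m : tiltable (fun x => g * (ecos 1 x ^+ n * ecos m x)).
Proof.
elim: n g m => [|n ih] g m.
  by under eq_fun do rewrite expr0 mul1r; exact: tiltable_ecos.
have [->|m0] := posnP m.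
  rewrite (_ : (fun _ => _) = fun x => g * (ecos 1 x ^+ n * ecos 1 x))//.
  by apply/funext => x; rewrite exprSr ecos0 mulr1.
rewrite (_ : (fun _ => _) = fun x => g / 2 * (ecos 1 x ^+ n * ecos (m + 1) x) +
  g / 2 * (ecos 1 x ^+ n * ecos (m - 1) x)); first exact: tiltableD.
by apply/funext => x; rewrite exprSr ecosD ecosB//; field.
Qed.

Lemma tiltable_horner_ecos1 (p : {poly R}) : tiltable (fun x => p.[ecos 1 x]).
Proof.
rewrite (_ : (fun x => _) = fun x =>
    \sum_(0 <= i < size p) p`_i * (ecos 1 x ^+ i * ecos 0 x)).
  by apply: tiltable_sum => i; exact: tiltable_ecos1X_ecos.
by apply/funext => x; rewrite horner_coef big_mkord; apply: eq_bigr => i _; rewrite ecos0 mulr1.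
Qed.

Lemma tiltable_symmetric T : continuous T -> (forall x, unitI x -> T (1 - x) = T x) ->
  tiltable T.
Proof.
move=> cT sT; apply: tiltable_uniform => [|eps eps0]; first exact: continuous_bounded_mfun.
have [p Tp] := symmetric_poly_ecos1 cT sT eps0.
by exists (fun x => p.[ecos 1 x]) => //; exact: tiltable_horner_ecos1.
Qed.

Theorem outweighed_symmetric (phi : R -> R) psi1 psi2 : continuous phi -> (forall x, 0 < phi x) ->
  (forall x, unitI x -> phi (1 - x) = phi x) -> weight psi1 -> weight psi2 ->
  mean (fun x => psi1 x * phi x) < mean (fun x => psi2 x * phi x) ->
  outweighed s psi1 psi2.
Proof.
move=> cphi phi0 sphi wpsi1 wpsi2 lt12.
have [bT tilt] : tiltable (fun x => ln (phi x)).
  apply: tiltable_symmetric => [x|x Ix]; last by rewrite sphi.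
  by apply: (@continuous_comp _ _ _ phi (@ln R)); [exact: cphi|exact: continuous_ln].
have bphi := continuous_bounded_mfun cphi.
have [[b1 psi10] [b2 psi20]] := (wpsi1, wpsi2).
set X := mean _ in lt12; set Y := mean _ in lt12.
have [d [d0 dXY]] : exists d, 0 < d /\ expR d * X < expR (- d) * Y.
  have lim : expR d * (expR d * X) @[d --> 0^'+] --> expR 0 * (expR 0 * X).
    apply: cvg_at_right_filter; apply: cvgM; first exact: continuous_expR.
    by apply: cvgM; [exact: continuous_expR|exact: cvg_cst].
  rewrite expR0 !mul1r in lim.
  apply: (@filter_ex _ 0^'+); near=> d; split; first by near: d; exact: nbhs_right_gt.
  rewrite expRN ltr_pdivlMl ?expR_gt0//; near: d; exact: cvgr_lt lim _ lt12.
apply: (tilt d) => //; apply: outweighed_lt_mean; move: dXY.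
rewrite -!meanZ; [|by auto with bounded_mfun..].
under [X in X < _ -> _]eq_mean do rewrite mulrCA.
under [X in _ < X -> _]eq_mean do rewrite mulrCA.
have expE a x : expR (ln (phi x) + a) = expR a * phi x by rewrite expRD lnK ?posrE// mulrC.
under [X in _ -> X < _]eq_mean do rewrite expE.
by under [X in _ -> _ < X]eq_mean do rewrite expE.
Unshelve. all: by end_near. Qed.

End Tilting.

Section SymmetricSets.
Context {R : realType}.
Implicit Types (A B C : set R) (d eta tau s x : R) (psi : R -> R).
Local Notation mu := (@lebesgue_measure R).

Definition symset B := [/\ measurable B, B `<=` unitI,
  (forall x, B x -> B (1 - x)) & (0 < mu B)%E].

Lemma indic_ge0 A x : 0 <= \1_A x :> R.
Proof. by rewrite indicE. Qed.

Lemma indicC A x : \1_(~` A) x = 1 - \1_A x :> R.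
Proof. by rewrite !indicE in_setC; case: (x \in A); rewrite ?subrr ?subr0. Qed.

Lemma le_indic A B x : A `<=` B -> \1_A x <= \1_B x :> R.
Proof.
move=> AB; rewrite !indicE ler_nat; case: (boolP (x \in A)) => //; rewrite inE => Ax.
by rewrite mem_set//; exact: AB.
Qed.

Lemma symset_indic_onem B : symset B -> forall x, \1_B (1 - x) = \1_B x :> R.
Proof.
move=> [_ _ sB _] x; rewrite !indicE; congr (nat_of_bool _)%:R.
by apply/idP/idP; rewrite !inE => /sB //; rewrite subKr.
Qed.

Lemma symset_mean_gt0 B : symset B -> 0 < mean (\1_B).
Proof. by move=> [mB BI _ muB]; rewrite -lte_fin -lebesgue_measure_mean. Qed.

Lemma symmetric_mean_approx psi d : bounded_mfun psi -> (forall x, 0 <= psi x) ->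
  (forall x, psi (1 - x) = psi x) -> 0 < d -> exists g : R -> R, [/\ continuous g,
    forall x, 0 <= g x, forall x, g (1 - x) = g x & mean (fun x => `|g x - psi x|) < d].
Proof.
move=> bpsi psi0 spsi d0; have [f cf fpsi] := continuous_mean_approx bpsi d0.
pose g x := 2^-1 * (`|f x| + `|f (1 - x)|).
have cg : continuous g.
  move=> x; apply: cvgMr; apply: cvgD; apply: cvg_norm; first exact: cf.
  by apply: continuous_comp; [apply: cvgB; [exact: cvg_cst|exact: cvg_id]|exact: cf].
exists g; split=> // [x|x|].
- by rewrite mulr_ge0 ?invr_ge0// addr_ge0.
- by rewrite /g subKr [`|f (1 - x)| + _]addrC.
have bf := continuous_bounded_mfun cf; have bg := continuous_bounded_mfun cg.
pose err x := `|psi x - f x|.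
have berr : bounded_mfun err by rewrite /err; auto with bounded_mfun.
apply: le_lt_trans fpsi; rewrite -/err.
have -> : mean err = mean (fun x => 2^-1 * (err x + err (1 - x))).
  by rewrite meanZ ?meanD ?mean_onem//; auto with bounded_mfun; field.
apply: le_mean => [||x _]; try by auto 10 with bounded_mfun.
have := ler_dist_dist (psi x) (f x); have := ler_dist_dist (psi (1 - x)) (f (1 - x)).
by rewrite /g /err spsi (ger0_norm (psi0 x)) !ler_norml; lra.
Qed.

(* [|P|^(2 s)] is made to imitate [d + phi], where the symmetric continuous
   function [phi] is close to the indicator of [B] in the mean. *)
Theorem outweighed_symset s B eta : 0 < s -> (forall n : nat, s != n%:R) ->
  symset B -> 0 < eta -> outweighed s (\1_(~` B)) (fun x => eta * \1_B x).
Proof.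
move=> s0 s_nat sB eta0; have [mB BI _ _] := sB; have m0 := symset_mean_gt0 sB.
set m := mean _ in m0.
pose d := eta * m / (2 * (2 + eta)).
have d0 : 0 < d by rewrite divr_gt0 ?mulr_gt0// addr_gt0.
have bB : bounded_mfun (\1_B : R -> R) := bounded_mfun_indic mB.
have bBc : bounded_mfun (\1_(~` B) : R -> R) := bounded_mfun_indic (measurableC mB).
have [g [cg g0 sg gB]] := symmetric_mean_approx bB (indic_ge0 B) (symset_indic_onem sB) d0.
have bg := continuous_bounded_mfun cg.
apply: (@outweighed_symmetric _ _ s0 s_nat (fun x => d + g x)).
- by move=> x; apply: cvgD; [exact: cvg_cst|exact: cg].
- by move=> x; rewrite ltr_pwDl.
- by move=> x _; rewrite sg.
- by apply: weight_indic; exact: measurableC.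
- by apply: weightZ (ltW eta0) _; exact: weight_indic.
have upper : mean (fun x => \1_(~` B) x * (d + g x)) <= d + mean (fun x => `|g x - \1_B x|).
  rewrite -[X in _ <= X + _]mean_cst -meanD; [|by auto with bounded_mfun..].
  apply: le_mean => [||x _]; [by auto 10 with bounded_mfun..|].
  rewrite indicC indicE; case: (x \in B).
    by rewrite subrr mul0r addr_ge0// ltW.
  by rewrite !subr0 mul1r lerD2l ler_norm.
have lower : eta * (m - mean (fun x => `|g x - \1_B x|)) <=
    mean (fun x => eta * \1_B x * (d + g x)).
  rewrite -meanB -?meanZ; [|by auto 10 with bounded_mfun..].
  apply: le_mean => [||x _]; [by auto 10 with bounded_mfun..|].
  rewrite -mulrA ler_wpM2l ?(ltW eta0)// indicE; case: (x \in B) => /=.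
    by have := ler_norm (1 - g x); rewrite distrC mul1r; move: d0; lra.
  by rewrite mul0r sub0r oppr_le0.
apply: (le_lt_trans upper); apply: lt_le_trans lower.
have -> : m = 2 * d * (2 + eta) / eta by rewrite /d; field; rewrite !gt_eqF// addr_gt0.
rewrite mulrBr mulrCA mulfV ?gt_eqF// mulr1.
nra.
Qed.

Lemma exists_itv_positive B (r : R) : measurable B -> B `<=` unitI -> (0 < mu B)%E ->
  0 < r -> exists i : nat, (0 < mu (B `&` `[(i%:R * r)%R, (i.+1%:R * r)%R[))%E.
Proof.
move=> mB BI muB r0; apply: contrapT => /forallNP null.
suff : mu B = 0%E by move=> B0; move: muB; rewrite B0 ltxx.
apply/negligibleP => //.
apply: (@negligibleS _ _ _ mu (\bigcup_i (B `&` `[(i%:R * r)%R, (i.+1%:R * r)%R[))).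
  move=> x Bx; have := BI _ Bx; rewrite /unitI/= in_itv/= => /andP[x0 _].
  exists (Num.truncn (x / r)) => //; split=> //=.
  rewrite in_itv/= -ler_pdivlMr// -ltr_pdivrMr//.
  by apply: truncn_itv; rewrite divr_ge0// ltW.
apply: negligible_bigcup => i; apply/negligibleP; first exact: measurableI.
by apply/eqP; rewrite eq_le measure_ge0 leNgt andbT; exact/negP/null.
Qed.

Lemma symset_shrink B tau : symset B -> 0 < tau ->
  exists C, [/\ symset C, C `<=` B & mean (\1_C) <= tau].
Proof.
move=> [mB BI sB muB] tau0; pose r := tau / 2; have r0 : 0 < r by rewrite divr_gt0.
have [i muBi] := exists_itv_positive mB BI muB r0.
set A : set R := `[_, _[%classic in muBi.
have mA : measurable A by exact: measurable_itv.
have mA' : measurable (reflection @^-1` A).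
  by rewrite -[X in measurable X]setTI; exact: measurable_reflection.
have muA : mu A = r%:E.
  rewrite /A lebesgue_measure_itv/= lte_fin ltr_pM2r// ltr_nat leqnn -EFinD.
  by rewrite -mulrBl -natrB// subSnn mul1r.
pose C := B `&` (A `|` reflection @^-1` A).
have mC : measurable C by apply: measurableI => //; exact: measurableU.
have CI : C `<=` unitI by move=> x [/BI].
exists C; split; [split=> //| by move=> x []|].
- move=> x [Bx Ax]; split; first exact: sB.
  by case: Ax => Ax; [right; rewrite /= /reflection subKr|left].
- apply: (lt_le_trans muBi); apply: le_measure; rewrite ?inE//; first exact: measurableI.
  by move=> x [Bx Ax]; split=> //; left.
rewrite -lee_fin -lebesgue_measure_mean//; apply: (@le_trans _ _ (mu (A `|` reflection @^-1` A))).
  by apply: le_measure; rewrite ?inE//; [exact: measurableU|move=> x []].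
apply: (@le_trans _ _ (mu A + mu (reflection @^-1` A))%E); first exact: measureU2.
rewrite lebesgue_measure_reflection// muA -EFinD lee_fin.
by rewrite /r -splitr.
Qed.

Lemma symset_setD B C : symset B -> symset C -> mean (\1_C) < mean (\1_B) -> C `<=` B ->
  symset (B `\` C).
Proof.
move=> [mB BI sB _] [mC _ sC _] CltB CB; have mD : measurable (B `\` C) by exact: measurableD.
have DI : B `\` C `<=` unitI by move=> x [/BI].
split=> // [x [Bx nCx]|]; first by split; [exact: sB|move=> /sC; rewrite subKr].
rewrite lebesgue_measure_mean// lte_fin.
have -> : mean (\1_(B `\` C)) = mean (fun x => \1_B x - \1_C x).
  apply: eq_mean => x _; rewrite !indicE in_setD.
  case: (boolP (x \in C)) => xC; last by rewrite andbT subr0.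
  by rewrite andbF (mem_set (CB _ (set_mem xC))) subrr.
by rewrite meanB ?subr_gt0//; exact: bounded_mfun_indic.
Qed.

Lemma disjoint_symsets B : symset B -> exists F : nat -> set R,
  [/\ forall k, symset (F k), forall k, F k `<=` B &
      forall j k, j != k -> F j `<=` ~` F k].
Proof.
move=> sB; pose T := {B : set R | symset B}.
have /choice[half halfP] : forall D : T, exists C : T,
    sval C `<=` sval D /\ symset (sval D `\` sval C).
  move=> [D sD]; have D0 := symset_mean_gt0 sD.
  have [|C [sC CD CltD]] := symset_shrink (tau := mean (\1_D) / 2) sD; first by rewrite divr_gt0.
  exists (exist _ C sC); split=> //=; apply: symset_setD => //.
  by rewrite (le_lt_trans CltD)// ltr_pdivrMr// ltr_pMr// ltr1n.
pose D n := sval (iter n half (exist _ B sB)).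
have D_nonincr m n : (m <= n)%N -> D n `<=` D m.
  move=> /subnKC <-; elim: (n - m)%N => [|k ih]; first by rewrite addn0.
  by rewrite addnS => x /(halfP _).1/ih.
have later j k : (j < k)%N -> D k `\` D k.+1 `<=` ~` (D j `\` D j.+1).
  by move=> jk x [Dkx _] [_]; apply; exact: (D_nonincr _ _ jk).
exists (fun k => D k `\` D k.+1); split=> [k|k x []|j k].
- exact: (halfP _).2.
- by move=> /(D_nonincr 0%N k (leq0n k)).
- rewrite neq_ltn => /orP[jk|kj]; last exact: later.
  by move=> x Fj Fk; exact: later jk x Fk Fj.
Qed.

End SymmetricSets.

Section ConcentratedPolynomials.
Context {R : realType}.
Implicit Types (P : {poly R}) (A B C : set R) (p q s t x : R).

Lemma powR_le_interpolate q p (a m : R) : 0 < q < p -> 0 < m -> 0 <= a ->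
  a `^ q <= m * a `^ p + m `^ (- (q / (p - q))).
Proof.
move=> /andP[q0 qp] m0 a0; have pq0 : 0 < p - q by rewrite subr_gt0.
pose b := m `^ (- (p - q)^-1); have b0 : 0 < b by rewrite powR_gt0.
have [ab|/ltW ba] := leP a b.
  rewrite ler_wpDl ?mulr_ge0 ?powR_ge0 ?(ltW m0)//.
  rewrite (_ : - (q / (p - q)) = - (p - q)^-1 * q); last by rewrite mulNr mulrC.
  by rewrite powRrM ge0_ler_powR ?nnegrE ?(ltW q0) ?(ltW b0).
rewrite ler_wpDr ?powR_ge0//; have agt0 : 0 < a := lt_le_trans b0 ba.
rewrite -[X in _ <= _ * a `^ X](subrK q) powRD ?(gt_eqF agt0) ?implybT// mulrA ler_peMl ?powR_ge0//.
rewrite -ler_pdivrMl// mulr1 (_ : m^-1 = b `^ (p - q)).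
  by rewrite ge0_ler_powR ?nnegrE ?(ltW pq0) ?(ltW b0) ?(ltW agt0).
by rewrite /b -powRrM mulNr mulVf ?gt_eqF// powR_inv1// ltW.
Qed.

Lemma mean_powR_interpolate (f : R -> R) C q p (m1 m2 : R) : 0 < q < p ->
  bounded_mfun f -> (forall x, 0 <= f x) -> measurable C -> 0 < m1 -> 0 < m2 ->
  mean (fun x => f x `^ q) <=
    m1 * mean (fun x => \1_C x * f x `^ p) + m1 `^ (- (q / (p - q))) * mean (\1_C) +
    (m2 * mean (fun x => \1_(~` C) x * f x `^ p) + m2 `^ (- (q / (p - q)))).
Proof.
move=> qp bf f0 mC m10 m20; have /andP[q0 /(lt_trans q0) p0] := qp.
have bC : bounded_mfun (\1_C : R -> R) := bounded_mfun_indic mC.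
have bCc : bounded_mfun (\1_(~` C) : R -> R) := bounded_mfun_indic (measurableC mC).
have bfq : bounded_mfun (fun x => f x `^ q) by apply: bounded_mfun_powR => //; exact: ltW.
have bfp : bounded_mfun (fun x => f x `^ p) by apply: bounded_mfun_powR => //; exact: ltW.
rewrite -[X in _ <= _ + (_ + X)]mean_cst.
rewrite -!meanZ -?meanD; [|by auto 10 with bounded_mfun..].
apply: le_mean => [||x _] //; first by auto 20 with bounded_mfun.
have := powR_le_interpolate qp m10 (f0 x); have := powR_le_interpolate qp m20 (f0 x).
rewrite indicC indicE; case: (x \in C) => /=.
  rewrite subrr mul0r !mul1r mulr1 mulr0 add0r => _ /le_trans; apply.
  by rewrite lerDl powR_ge0.
by rewrite subr0 mul0r !mulr0 !add0r mul1r.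
Qed.

Variables (s : R) (s_gt0 : 0 < s) (s_nat : forall n : nat, s != n%:R).

Lemma exists_concentrated_poly B eta D G : symset B -> 0 < eta -> 0 < D ->
  exists P, [/\ gapped G P, mean (fun x => \1_B x * sqmod P x `^ s) = D &
    mean (fun x => \1_(~` B) x * sqmod P x `^ s) <= eta].
Proof.
move=> sB eta0 D0; have [mB _ _ _] := sB.
have bB := bounded_mfun_indic mB; have bBc := bounded_mfun_indic (measurableC mB).
have eD0 : 0 < eta / D by rewrite divr_gt0.
have [P gP] := outweighed_symset s_gt0 s_nat sB eD0 G.
have bP := bounded_mfun_sqmod_powR P (ltW s_gt0).
under [X in _ < X -> _]eq_mean do rewrite -mulrA.
rewrite meanZ; last exact: bounded_mfunM.
set X := mean (fun x => \1_B x * _) => ltX.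
have X0 : 0 < X.
  rewrite -(pmulr_rgt0 _ eD0); apply: le_lt_trans ltX; apply: mean_ge0 => x _.
  by rewrite mulr_ge0 ?indic_ge0 ?powR_ge0.
pose c := (D / X) `^ (2 * s)^-1; have c0 : 0 < c by rewrite powR_gt0// divr_gt0.
have c2s : (c ^+ 2) `^ s = D / X.
  rewrite -powR_mulrn ?(ltW c0)// -powRrM /c -powRrM mulVf ?powRr1 ?divr_ge0 ?ltW//.
  by rewrite gt_eqF// mulr_gt0.
have meanE (psi : R -> R) : bounded_mfun psi ->
    mean (fun x => psi x * sqmod (c *: P) x `^ s) =
    D / X * mean (fun x => psi x * sqmod P x `^ s).
  move=> bpsi; rewrite -meanZ; last exact: bounded_mfunM.
  by apply: eq_mean => x _; rewrite sqmodZ powRM ?sqr_ge0 ?sqmod_ge0// c2s mulrCA.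
exists (c *: P); split; first exact: gappedZ.
- by rewrite meanE// divfK// gt_eqF.
- rewrite meanE// mulrC -ler_pdivlMr ?divr_gt0// (le_trans (ltW ltX))//.
  by rewrite invf_div mulrA mulrAC.
Qed.

(* Concentrating on a small enough subset of [B] makes the mean of order [t] small. *)
Lemma exists_concentrated_poly_small t B eta D G : 0 < t < s -> symset B ->
  0 < eta -> 0 < D ->
  exists P, [/\ gapped G P, D <= mean (fun x => \1_B x * sqmod P x `^ s),
    mean (fun x => \1_(~` B) x * sqmod P x `^ s) <= eta &
    mean (fun x => sqmod P x `^ t) <= eta].
Proof.
move=> ts sB eta0 D0; have [t0 tlts] := andP ts; have [mB _ _ _] := sB.
have st0 : 0 < s - t by rewrite subr_gt0.
have eta4 : 0 < eta / 4 by rewrite divr_gt0.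
pose e := t / (s - t); have e0 : 0 < e by rewrite divr_gt0.
pose m1 := eta / 4 / D; have m10 : 0 < m1 by rewrite divr_gt0.
pose m2 := (eta / 4) `^ (- e^-1); have m20 : 0 < m2 by rewrite powR_gt0.
have m1e : 0 < m1 `^ (- e) by rewrite powR_gt0.
have m2e : m2 `^ (- e) = eta / 4.
  by rewrite /m2 -powRrM mulrNN mulVf ?gt_eqF// powRr1// ltW.
have [|C [sC CB Csmall]] := symset_shrink (tau := eta / 4 / m1 `^ (- e)) sB.
  by rewrite divr_gt0.
have [mC _ _ _] := sC; pose eta1 := Num.min eta (eta / 4 / m2).
have eta10 : 0 < eta1 by rewrite lt_min eta0 divr_gt0.
have [P [gP PC PCc]] := exists_concentrated_poly G sC eta10 D0.
have bP := bounded_mfun_sqmod_powR P (ltW s_gt0).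
have mono A A' : measurable A -> measurable A' -> A `<=` A' ->
    mean (fun x => \1_A x * sqmod P x `^ s) <= mean (fun x => \1_A' x * sqmod P x `^ s).
  move=> mA mA' AA'; have bA := bounded_mfun_indic mA; have bA' := bounded_mfun_indic mA'.
  apply: le_mean => [||x _]; [exact: bounded_mfunM|exact: bounded_mfunM|].
  by rewrite ler_wpM2r ?powR_ge0// le_indic.
exists P; split=> //.
- by rewrite -PC mono.
- rewrite (le_trans (mono _ _ (measurableC mB) (measurableC mC) (subsetC CB)))//.
  by rewrite (le_trans PCc)// ge_min lexx.
apply: le_trans (mean_powR_interpolate ts (bounded_mfun_sqmod P) (sqmod_ge0 P) mC m10 m20) _.
rewrite -/e PC m2e /m1 divfK ?gt_eqF//.
have : m1 `^ (- e) * mean (\1_C) <= eta / 4 by rewrite mulrC -ler_pdivlMr.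
have : m2 * mean (fun x => \1_(~` C) x * sqmod P x `^ s) <= eta / 4.
  by rewrite mulrC -ler_pdivlMr// (le_trans PCc)// ge_min lexx orbT.
by rewrite -/m1; clear; lra.
Qed.

End ConcentratedPolynomials.

Section DominatedSeries.
Context {R : realType}.
Implicit Types (b v : R ^nat) (n : nat) (y : R).

Lemma dominated_series_cvg v b : (forall k, `|v k| <= b k) -> cvgn (series b) ->
  cvgn (series v).
Proof.
move=> vb cb; apply: normed_cvg; apply: (series_le_cvg _ _ vb cb) => n; first exact: normr_ge0.
exact: le_trans (vb n).
Qed.

Lemma dominated_series_tail v b n : (forall k, `|v k| <= b k) -> cvgn (series b) ->
  `|limn (series v) - series v n| <= limn (series b) - series b n.
Proof.
move=> vb cb; have cv := dominated_series_cvg vb cb.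
have lim_v : `|series v m - series v n| @[m --> \oo] --> `|limn (series v) - series v n|.
  by apply: cvg_norm; apply: cvgB => //; exact: cvg_cst.
have lim_b : series b m - series b n @[m --> \oo] --> limn (series b) - series b n.
  by apply: cvgB => //; exact: cvg_cst.
apply: ler_cvg_to lim_v lim_b _; exists n => // m /= nm.
rewrite !sub_series nm (le_trans (ler_norm_sum _ _ _))//; exact: ler_sum.
Qed.

Lemma norm_lim_series_le v b : (forall k, `|v k| <= b k) -> cvgn (series b) ->
  `|limn (series v)| <= limn (series b).
Proof.
by move=> vb cb; have := dominated_series_tail 0 vb cb; rewrite /series/= !big_geq// !subr0.
Qed.

Lemma tannery (T : Type) (F : set_system T) (FF : ProperFilter F) (u : nat -> T -> R) v b :
  cvgn (series b) -> (forall k, u k r @[r --> F] --> v k) ->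
  (\forall r \near F, forall k, `|u k r| <= b k) ->
  limn (series (u ^~ r)) @[r --> F] --> limn (series v).
Proof.
move=> cb uv ub.
have vb k : `|v k| <= b k.
  by apply: (cvgr_to_le (cvg_norm (uv k) : `|u k r| @[r --> F] --> _)); apply: filterS ub.
apply/cvgrPdist_le => e e0; have e3 : 0 < e / 3 by rewrite divr_gt0.
have [n bn] : exists n, limn (series b) - series b n <= e / 3.
  have /cvgrPdist_le/(_ _ e3)[n _ hn] := cb.
  by exists n; rewrite (le_trans (ler_norm _))//; exact: (hn n (leqnn n)).
have : series (u ^~ r) n @[r --> F] --> series v n.
  rewrite /series/=; elim: n {bn} => [|n ih].
    by rewrite big_geq//; under eq_fun do rewrite big_geq//; exact: cvg_cst.
  rewrite big_nat_recr//=; under eq_fun do rewrite big_nat_recr//=.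
  by apply: cvgD; [exact: ih|exact: uv].
move=> /cvgrPdist_le/(_ _ e3); apply: filterS2 ub => r ubr near_n.
have tail_v := dominated_series_tail n vb cb.
have tail_u := dominated_series_tail n ubr cb.
rewrite (_ : limn (series v) - _ = (limn (series v) - series v n) +
  (series v n - series (u ^~ r) n) - (limn (series (u ^~ r)) - series (u ^~ r) n)).
  rewrite (le_trans (ler_normB _ _))// (le_trans (lerD (ler_normD _ _) (lexx _)))//.
  by move: tail_v tail_u near_n bn; lra.
by ring.
Qed.

Lemma cvg_series_half y : series (fun k => y * 2^-1 ^+ k) @ \oo --> 2 * y.
Proof.
rewrite (_ : 2 * y = y * (1 - 2^-1)^-1); last by field.
by apply: cvg_geometric_series; rewrite ger0_norm ?invr_ge0// invf_lt1// ltr1n.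
Qed.

Lemma norm_lim_series_half v y : (forall k, `|v k| <= y * 2^-1 ^+ k) ->
  `|limn (series v)| <= 2 * y.
Proof.
move=> vy; rewrite -(cvg_lim (@Rhausdorff R) (@cvg_series_half y)).
by apply: norm_lim_series_le => //; apply: cvgP; exact: cvg_series_half.
Qed.

Lemma series_half_cvg v y : (forall k, `|v k| <= y * 2^-1 ^+ k) -> cvgn (series v).
Proof.
by move=> /dominated_series_cvg; apply; apply: cvgP; exact: cvg_series_half.
Qed.

Lemma series_half_off_one v k y : 0 <= y ->
  (forall j, j != k -> `|v j| <= y * 2^-1 ^+ j) ->
  cvgn (series v) /\ `|v k| <= `|limn (series v)| + 2 * y.
Proof.
move=> y0 vy; pose w j := if j == k then 0 else v j.
have wy j : `|w j| <= y * 2^-1 ^+ j.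
  rewrite /w; have [_|] := eqVneq j k; last exact: vy.
  by rewrite normr0 mulr_ge0// exprn_ge0// invr_ge0.
have vE : \forall n \near \oo, series v n = series w n + v k.
  exists k.+1 => // n /= kn; rewrite /series/=.
  rewrite [LHS](bigD1_seq k) ?iota_uniq ?mem_index_iota//= addrC; congr (_ + _).
  rewrite [RHS](bigD1_seq k) ?iota_uniq ?mem_index_iota//= {1}/w eqxx add0r.
  by apply: eq_bigr => j jk; rewrite /w (negbTE jk).
have cw := series_half_cvg wy.
have lim_v : series v @ \oo --> limn (series w) + v k.
  apply: (@cvg_trans _ ((fun n => series w n + v k) @ \oo)).
    by apply: near_eq_cvg; apply: filterS vE => n ->.
  by apply: cvgD => //; exact: cvg_cst.
split; first exact: (cvgP _ lim_v).
rewrite (cvg_lim (@Rhausdorff R) lim_v).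
have := norm_lim_series_half wy; have := ler_normB (limn (series w) + v k) (limn (series w)).
by rewrite addrAC subrr add0r; lra.
Qed.

Definition series_limit (u : nat -> R -> R) (t : R) : R :=
  fine (limn_esup (fun n => (series (u ^~ t) n)%:E)).

Lemma measurable_series_limit u : (forall k, measurable_fun [set: R] (u k)) ->
  measurable_fun [set: R] (series_limit u).
Proof.
move=> mu; apply: measurableT_comp => //.
apply: measurable_fun_limn_esup => n; apply/measurable_EFinP.
exact: measurable_sum.
Qed.

Lemma series_limitE u t : cvgn (series (u ^~ t)) ->
  series_limit u t = limn (series (u ^~ t)).
Proof.
move=> cu; rewrite /series_limit.
suff /cvg_limn_einf_sup[_ ->] :
  (fun n => (series (u ^~ t) n)%:E) @ \oo --> (limn (series (u ^~ t)))%:E by [].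
by apply: cvg_EFin; [exact: nearW|exact: cu].
Qed.

End DominatedSeries.

Section DyadicSums.
Context {d : measure_display} {T : measurableType d} {R : realType}.
Variables (mu : {measure set T -> \bar R}) (e : R) (A : nat -> T -> R) (D : set T).
Hypotheses (e_gt0 : 0 < e) (mA : forall k, measurable_fun [set: T] (A k))
  (A_ge0 : forall k t, 0 <= A k t) (mD : measurable D).
Implicit Types (t : T) (x y : R) (k : nat).

Definition dyadic_tolerance k : R := (2 ^ k.+1)%:R^-1 / (2 ^+ k) `^ e.

Hypothesis A_small : forall k,
  (\int[mu]_(t in D) ((A k t) `^ e)%:E <= (dyadic_tolerance k)%:E)%E.

(* Controls all the [A k t] at once, whether or not [e >= 1]. *)
Definition dyadic_sum t : \bar R := (\sum_(0 <= k <oo) ((2 ^+ k * A k t) `^ e)%:E)%E.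

Let summand_ge0 k t : (0 <= ((2 ^+ k * A k t) `^ e)%:E)%E.
Proof. by rewrite lee_fin powR_ge0. Qed.

Let measurable_summand k : measurable_fun [set: T] (fun t => ((2 ^+ k * A k t) `^ e)%:E).
Proof.
apply/measurable_EFinP; apply: (measurableT_comp (measurable_powR e)).
exact: measurable_funM.
Qed.

Lemma dyadic_sum_ge0 t : (0 <= dyadic_sum t)%E.
Proof. exact: nneseries_ge0. Qed.

Lemma measurable_dyadic_sum : measurable_fun D dyadic_sum.
Proof.
apply: measurable_funTS.
by apply: (@ge0_emeasurable_sum _ _ _ setT
  (fun k t => ((2 ^+ k * A k t) `^ e)%:E) xpredT) => k // _; exact: measurable_summand.
Qed.

Lemma integral_dyadic_sum_le1 : (\int[mu]_(t in D) dyadic_sum t <= 1)%E.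
Proof.
rewrite /dyadic_sum integral_nneseries//; last first.
  by move=> k; apply: measurable_funTS; exact: measurable_summand.
apply: le_trans (epsilon_trick0 xpredT ler01); apply: lee_nneseries.
  by move=> k _ _; exact: integral_ge0.
move=> k _; have pow0 : 0 < (2 ^+ k : R) `^ e by rewrite powR_gt0// exprn_gt0.
under eq_integral do rewrite powRM ?exprn_ge0// EFinM.
rewrite ge0_integralZl_EFin ?(ltW pow0)//; first last.
- apply: measurable_funTS; apply/measurable_EFinP.
  exact: (measurableT_comp (measurable_powR e)).
- by move=> t _; rewrite lee_fin powR_ge0.
apply: (le_trans (lee_wpmul2l _ (A_small k))); first by rewrite lee_fin ltW.
by rewrite -EFinM lee_fin /dyadic_tolerance div1r mulrCA mulfV ?gt_eqF// mulr1.
Qed.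

Lemma dyadic_sum_bound t : (dyadic_sum t < +oo)%E ->
  forall k, A k t <= (fine (dyadic_sum t)) `^ e^-1 * 2^-1 ^+ k.
Proof.
move=> St_fin k.
have St : dyadic_sum t \is a fin_num by rewrite ge0_fin_numE// dyadic_sum_ge0.
have leS : (2 ^+ k * A k t) `^ e <= fine (dyadic_sum t).
  rewrite -lee_fin fineK//; apply: le_trans (nneseries_lim_ge k.+1 _) => //.
  by rewrite big_nat_recr//= leeDr// sume_ge0.
rewrite exprVn ler_pdivlMr ?exprn_gt0// mulrC.
have x0 : 0 <= 2 ^+ k * A k t by rewrite mulr_ge0// exprn_ge0.
have -> : 2 ^+ k * A k t = ((2 ^+ k * A k t) `^ e) `^ e^-1.
  by rewrite -powRrM mulfV ?gt_eqF// powRr1.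
rewrite ge0_ler_powR ?invr_ge0 ?(ltW e_gt0) ?nnegrE ?powR_ge0//.
by rewrite fine_ge0// dyadic_sum_ge0.
Qed.

Lemma ae_dyadic_bound : {ae mu, forall t, D t ->
  exists2 y, 0 <= y & forall k, A k t <= y * 2^-1 ^+ k}.
Proof.
have intS : mu.-integrable D dyadic_sum.
  apply/integrableP; split; first exact: measurable_dyadic_sum.
  under eq_integral do rewrite gee0_abs ?dyadic_sum_ge0//.
  by rewrite (le_lt_trans integral_dyadic_sum_le1)// ltry.
apply: filterS (integrable_ae mD intS) => t h Dt.
exists ((fine (dyadic_sum t)) `^ e^-1); first exact: powR_ge0.
by apply: dyadic_sum_bound; rewrite -ge0_fin_numE ?dyadic_sum_ge0//; exact: h.
Qed.

Lemma powRD_le x y : 0 <= x -> 0 <= y -> (x + y) `^ e <= 2 `^ e * (x `^ e + y `^ e).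
Proof.
wlog xy : x y / x <= y => [wlog_xy|] x0 y0.
  by have [xy|/ltW yx] := leP x y; [|rewrite addrC [_ + y `^ e]addrC]; exact: wlog_xy.
apply: (@le_trans _ _ ((2 * y) `^ e)).
  by rewrite ge0_ler_powR ?nnegrE ?mulr_ge0 ?addr_ge0 ?(ltW e_gt0)//; lra.
by rewrite powRM// ler_wpM2l ?powR_ge0// lerDr powR_ge0.
Qed.

Lemma integral_powR_le_dyadic (a c : T -> R) :
  measurable_fun [set: T] a -> measurable_fun [set: T] c ->
  (forall t, 0 <= a t) -> (forall t, 0 <= c t) ->
  (forall t y, D t -> 0 <= y -> (forall k, A k t <= y * 2^-1 ^+ k) ->
    a t <= 4 * (c t + y)) ->
  (\int[mu]_(t in D) ((a t) `^ e)%:E <=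
   (8 `^ e)%:E * (\int[mu]_(t in D) ((c t) `^ e)%:E + 1))%E.
Proof.
move=> ma mc a0 c0 ac.
have measurable_powR_e f : measurable_fun [set: T] f ->
    measurable_fun D (fun t => ((f t) `^ e)%:E).
  move=> mf; apply: measurable_funTS; apply/measurable_EFinP.
  exact: (measurableT_comp (measurable_powR e)).
have mS := measurable_dyadic_sum.
have ce0 t : (0 <= ((c t) `^ e)%:E)%E by rewrite lee_fin powR_ge0.
apply: (@le_trans _ _ (\int[mu]_(t in D)
    ((8 `^ e)%:E * (((c t) `^ e)%:E + dyadic_sum t)))%E).
  apply: ge0_le_integral => //.
  - by move=> t _; rewrite lee_fin powR_ge0.
  - exact: measurable_powR_e.
  - by apply: measurable_funeM; apply: emeasurable_funD => //; exact: measurable_powR_e.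
  move=> t Dt; have [St_fin|] := ltP (dyadic_sum t) +oo%E; last first.
    by rewrite leye_eq => /eqP->; rewrite addey// gt0_muley ?leey// lte_fin powR_gt0.
  have St : dyadic_sum t \is a fin_num by rewrite ge0_fin_numE ?dyadic_sum_ge0.
  set y := (fine (dyadic_sum t)) `^ e^-1; have y0 : 0 <= y by exact: powR_ge0.
  have yE : fine (dyadic_sum t) = y `^ e.
    by rewrite /y -powRrM mulVf ?gt_eqF// powRr1// fine_ge0// dyadic_sum_ge0.
  rewrite -(fineK St) -EFinD -EFinM lee_fin yE.
  apply: (@le_trans _ _ ((4 * (c t + y)) `^ e)).
    rewrite ge0_ler_powR ?nnegrE ?(ltW e_gt0)// ?mulr_ge0 ?addr_ge0//.
    by apply: ac => //; exact: dyadic_sum_bound.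
  rewrite powRM ?addr_ge0// (_ : 8 = 4 * 2 :> R); last by ring.
  by rewrite powRM// -mulrA ler_wpM2l ?powR_ge0// powRD_le.
rewrite ge0_integralZl_EFin ?powR_ge0//; first last.
- by apply: emeasurable_funD => //; exact: measurable_powR_e.
- by move=> t _; rewrite adde_ge0 ?dyadic_sum_ge0.
rewrite lee_wpmul2l ?lee_fin ?powR_ge0// ge0_integralD//; first last.
- by move=> t _; exact: dyadic_sum_ge0.
- exact: measurable_powR_e.
by rewrite leeD2l// integral_dyadic_sum_le1.
Qed.

End DyadicSums.

Section PowerEstimates.
Context {R : realType}.
Implicit Types (r x : R) (i k n : nat).

Lemma succ_onem_exprn_le1 x n : 0 <= x <= 1 -> n.+1%:R * (1 - x) * x ^+ n <= 1.
Proof.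
move=> /andP[x0 x1]; elim: n => [|n ih]; first by rewrite mul1r expr0 mulr1 gerBl.
have : n.+1%:R * (1 - x) * x ^+ n * x <= x by rewrite ler_piMl.
have : x * x ^+ n <= 1 by rewrite -exprS exprn_ile1.
by rewrite exprS -natr1; clear - x0 x1; nra.
Qed.

Lemma onem_exprn_le r i : 0 <= r <= 1 -> 1 - r ^+ i <= i%:R * (1 - r).
Proof.
move=> /andP[r0 r1]; elim: i => [|i ih]; first by rewrite mul0r expr0 subrr.
have : r ^+ i <= 1 by rewrite exprn_ile1.
by rewrite exprS -natr1; nra.
Qed.

Lemma exprn_onem_exprn_le r n i : 0 <= r <= 1 -> r ^+ n * (1 - r ^+ i) <= i%:R / n.+1%:R.
Proof.
move=> r01; have [r0 r1] := andP r01.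
apply: (@le_trans _ _ (r ^+ n * (i%:R * (1 - r)))).
  by rewrite ler_wpM2l ?exprn_ge0// onem_exprn_le.
rewrite ler_pdivlMr ?ltr0n// mulrCA -mulrA ler_piMr//.
by apply: le_trans (succ_onem_exprn_le1 n r01); rewrite mulrC [r ^+ n * _]mulrC mulrA.
Qed.

Lemma distribution_coefs_summable (a c : nat -> R) r : distribution_coefs a ->
  0 < r < 1 -> (forall n, `|c n| <= 1) -> cvgn (series (fun n => a n * r ^+ n * c n)).
Proof.
move=> [C [k aC]] /andP[r0 r1] c1; pose x := r `^ k.+1%:R^-1.
have x0 : 0 < x by rewrite powR_gt0.
have xk : x ^+ k.+1 = r by rewrite -powR_mulrn ?ltW// -powRrM mulVf// powRr1// ltW.
have x1 : x < 1.
  by rewrite ltNge; apply/negP => /(exprn_ege1 k.+1); rewrite xk leNgt r1.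
have C0 : 0 <= C by have := le_trans (normr_ge0 _) (aC 0%N); rewrite expr1n mulr1.
apply: (@dominated_series_cvg _ _ (geometric (C * (1 - x) ^- k) x)); last first.
  by apply: is_cvg_geometric_series; rewrite ger0_norm ?ltW.
move=> n; have xn0 : 0 <= x ^+ n by rewrite exprn_ge0 ?ltW.
have nx : n.+1%:R * x ^+ n <= (1 - x)^-1.
  rewrite -[leRHS]mul1r ler_pdivlMr ?subr_gt0// mulrAC.
  by apply: succ_onem_exprn_le1; rewrite !ltW.
rewrite !normrM [`|r ^+ n|]ger0_norm ?exprn_ge0 ?(ltW r0)//.
apply: (@le_trans _ _ (C * n.+1%:R ^+ k * r ^+ n * 1)).
  by rewrite ler_pM// ?mulr_ge0 ?exprn_ge0 ?(ltW r0)// ler_wpM2r ?exprn_ge0 ?(ltW r0).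
have -> : C * n.+1%:R ^+ k * r ^+ n * 1 = C * (n.+1%:R * x ^+ n) ^+ k * x ^+ n.
  by rewrite mulr1 -xk exprMn -!exprM mulSn exprD [(k * n)%N]mulnC; ring.
rewrite ler_wpM2r// ler_wpM2l// -exprVn lerXn2r ?nnegrE ?mulr_ge0//.
by rewrite invr_ge0 subr_ge0 ltW.
Qed.

End PowerEstimates.

Lemma increasing_enumeration (S : pred nat) : (forall n, exists2 m, (n < m)%N & S m) ->
  exists f : nat -> nat, [/\ forall k, (f k < f k.+1)%N, forall k, S (f k) &
    forall m, S m -> exists k, m = f k].
Proof.
move=> S_inf; have nextP n : exists m, (n < m)%N && S m.
  by have [m nm Sm] := S_inf n; exists m; rewrite nm.
have S_ex : exists m, S m by have [m _ Sm] := S_inf 0%N; exists m.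
pose next n := ex_minn (nextP n); pose f k := iter k next (ex_minn S_ex).
have nextE n : [/\ (n < next n)%N, S (next n) &
    forall m, (n < m)%N -> S m -> (next n <= m)%N].
  rewrite /next; case: ex_minnP => m /andP[nm Sm] m_min; split=> // m' nm' Sm'.
  by apply: m_min; rewrite nm'.
have fS k : f k.+1 = next (f k) by [].
have f_lt k : (f k < f k.+1)%N by rewrite fS; case: (nextE (f k)).
have f_ge k : (k <= f k)%N by elim: k => // k ih; exact: leq_ltn_trans (f_lt k).
exists f; split=> // [[|k]|m Sm].
- by rewrite /f/=; case: ex_minnP.
- by rewrite fS; case: (nextE (f k)).
have [K mK] : exists K, (m < f K)%N by exists m.+1; exact: f_ge.
elim: K mK => [|K ih mK].
  by rewrite /f/=; case: ex_minnP => n _ /(_ m Sm) nm; rewrite ltnNge nm.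
have [mK'|] := ltnP m (f K); first exact: ih.
rewrite leq_eqVlt => /predU1P[<-|Km]; first by exists K.
have [_ _ /(_ _ Km Sm)] := nextE (f K).
by rewrite -fS leqNgt mK.
Qed.

Section ShiftedBlocks.
Context {R : realType}.
Implicit Types (P : nat -> {poly R}) (M : nat -> nat).

Definition admissible_shifts P M := [/\
  forall k, (M k + size (P k) + k < M k.+1)%N,
  forall k i, (P k)`_i <= (M k)%:R &
  forall k, coef_sum (fun i => i%:R) (P k) <= 2^-1 ^+ k * (M k).+1%:R].

Lemma exists_admissible_shifts P : (forall k i, 0 <= (P k)`_i) ->
  exists M, admissible_shifts P M.
Proof.
move=> P0.
pose c k := coef_sum (fun=> 1) (P k); pose m k := coef_sum (fun i => i%:R) (P k) * 2 ^+ k.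
have c0 k : 0 <= c k by apply: sumr_ge0 => i _; rewrite mulr1.
have m0 k : 0 <= m k.
  by rewrite mulr_ge0 ?exprn_ge0//; apply: sumr_ge0 => i _; rewrite mulr_ge0.
pose n k := Num.bound (c k + m k).
have cmn k : c k + m k < (n k)%:R by rewrite archi_boundP// addr_ge0.
pose M := fix M k := if k is j.+1 then (M j + size (P j) + j + 1 + n j.+1)%N else n 0%N.
have nM k : (n k)%:R <= (M k)%:R :> R by rewrite ler_nat; case: k => [|k] //=; exact: leq_addl.
exists M; split=> [k|k i|k] /=.
- by rewrite addn1 addSn ltnS leq_addr.
- apply: (@le_trans _ _ (c k)); last by have := cmn k; have := nM k; have := m0 k; lra.
  have [ik|ki] := ltnP i (size (P k)); last by rewrite nth_default.
  rewrite /c /coef_sum (bigD1_seq i) ?iota_uniq ?mem_index_iota//= mulr1 lerDl.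
  by apply: sumr_ge0 => j _; rewrite mulr1.
- rewrite mulrC exprVn ler_pdivlMr ?exprn_gt0// -/(m k) -natr1.
  by have := cmn k; have := nM k; have := c0 k; lra.
Qed.

Variables (P : nat -> {poly R}) (M : nat -> nat).
Hypotheses (P_ge0 : forall k i, 0 <= (P k)`_i) (adm : admissible_shifts P M).
Implicit Types (F : nat -> R -> R) (r t : R) (j k n : nat).

Definition block k := P k * 'X^(M k).

(* The blocks of index k > n do not reach n. *)
Definition blocks_coef n := \sum_(0 <= k < n.+1) (block k)`_n.

Definition block_sum F k r t := coef_sum (fun n => r ^+ n * F n t) (block k).

Lemma block_sumE F k r t :
  block_sum F k r t = coef_sum (fun i => r ^+ (i + M k) * F (i + M k)%N t) (P k).
Proof. exact: coef_sumMXn. Qed.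

Let M_lt j k : (j < k)%N -> (M j + size (P j) + j < M k)%N.
Proof.
have [M_step _ _] := adm.
elim: k => // k ih; rewrite ltnS leq_eqVlt => /predU1P[->|/ih jk]; first exact: M_step.
by rewrite (leq_trans jk)// (leq_trans _ (ltnW (M_step k)))// -addnA leq_addr.
Qed.

Let M_ge k : (k <= M k)%N.
Proof.
elim: k => // k ih; rewrite (leq_trans _ (M_lt (ltnSn k)))// ltnS (leq_trans ih)//.
by rewrite -addnA leq_addr.
Qed.

Let M_mono j k : (j <= k)%N -> (M j <= M k)%N.
Proof.
rewrite leq_eqVlt => /predU1P[->//|/M_lt/ltnW]; apply: leq_trans.
by rewrite -addnA leq_addr.
Qed.

Lemma blocks_coef_widen K n : (n < M K)%N -> blocks_coef n = \sum_(0 <= k < K) (block k)`_n.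
Proof.
move=> nK.
have widen m m' : (m <= m')%N -> (forall k, (m <= k)%N -> (n < M k)%N) ->
    \sum_(0 <= k < m) (block k)`_n = \sum_(0 <= k < m') (block k)`_n.
  move=> mm h; rewrite [RHS](big_cat_nat (n := m))//=.
  rewrite [X in _ = _ + X]big_nat [X in _ = _ + X]big1 ?addr0//.
  by move=> k /andP[mk _]; rewrite coefMXn h.
have hK k : (K <= k)%N -> (n < M k)%N by move=> /M_mono; exact: leq_trans nK.
have hn k : (n.+1 <= k)%N -> (n < M k)%N by move=> nk; exact: leq_trans (M_ge k).
have [le|/ltnW le] := leqP K n.+1; first by rewrite [RHS](widen _ n.+1).
by rewrite /blocks_coef (widen _ K).
Qed.

Lemma blocks_coef_ge0 n : 0 <= blocks_coef n.
Proof. by apply: sumr_ge0 => k _; rewrite coefMXn; case: ifP. Qed.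

Lemma blocks_coef_neq0 n : blocks_coef n != 0 ->
  exists2 k, (M k <= n)%N & (P k)`_(n - M k) != 0.
Proof.
move=> an0; apply: contrapT => h; move/negP: an0; apply; apply/eqP.
rewrite /blocks_coef big1// => k _; rewrite coefMXn; case: ltnP => // Mn.
by apply: contrapT => /eqP nz; apply: h; exists k.
Qed.

Lemma distribution_blocks_coef : distribution_coefs blocks_coef.
Proof.
have [_ P_le _] := adm; exists 1, 2%N => n; rewrite mul1r ger0_norm ?blocks_coef_ge0//.
apply: (@le_trans _ _ (\sum_(0 <= k < n.+1) n.+1%:R)); last first.
  by rewrite sumr_const_nat subn0 -[leLHS]mulr_natr expr2.
apply: ler_sum => k _; rewrite coefMXn; case: ltnP => // Mn.
by rewrite (le_trans (P_le k _))// ler_nat (leq_trans Mn).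
Qed.

Lemma gaps_blocks_coef :
  (forall k i j, (i < j)%N -> (P k)`_i != 0 -> (P k)`_j != 0 -> (k <= j - i)%N) ->
  (forall k, (P k)`_0 != 0) -> gaps_to_infty blocks_coef.
Proof.
move=> gapP P00; pose inblock k n := (M k <= n)%N && ((P k)`_(n - M k) != 0).
have inblock_lt k n : inblock k n -> (n < M k + size (P k))%N.
  move=> /andP[Mn nz]; rewrite -ltn_subLR// ltnNge; apply: contra nz => le.
  by rewrite nth_default.
have [] := @increasing_enumeration (fun n => `[< exists k, inblock k n >]).
  move=> n; exists (M n.+1); first exact: leq_trans (M_ge _).
  by apply/asboolP; exists n.+1; rewrite /inblock leqnn subnn P00.
move=> nk [nk_lt Snk enum]; exists nk; split=> //; split.
  move=> m /blocks_coef_neq0[k Mm nz]; apply: enum.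
  by apply/asboolP; exists k; rewrite /inblock Mm.
have nk_ge k : (k <= nk k)%N by elim: k => // k ih; exact: leq_ltn_trans (nk_lt k).
move=> G; exists (M G) => k Gk.
have /asboolP[k1 b1] := Snk k; have /asboolP[k2 b2] := Snk k.+1.
have l1 := inblock_lt _ _ b1; have l2 := inblock_lt _ _ b2; have lt12 := nk_lt k.
have Gk1 : (G <= k1)%N.
  by rewrite leqNgt; apply/negP => /M_lt; have := nk_ge k; clear - Gk l1; lia.
move: b1 b2 => /andP[M1 nz1] /andP[M2 nz2].
have [/M_lt|/M_lt|k12] := ltngtP k1 k2; [by clear - M2 l1 Gk1; lia|by clear - M1 l2 lt12; lia|].
subst k2; have := gapP k1 (nk k - M k1)%N (nk k.+1 - M k1)%N; rewrite ltn_sub2r//; last first.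
  by clear - M1 lt12; lia.
by move=> /(_ isT nz1 nz2); clear - M1 lt12 Gk1; lia.
Qed.

Lemma series_blocks_coef F r t K :
  series (fun n => blocks_coef n * r ^+ n * F n t) (M K) =
  \sum_(0 <= k < K) block_sum F k r t.
Proof.
rewrite /series/= big_nat.
under eq_bigr => n /andP[_ nK] do rewrite (blocks_coef_widen nK) -mulrA mulr_suml.
rewrite -big_nat exchange_big/= big_nat [RHS]big_nat; apply: eq_bigr => k /andP[_ kK].
rewrite /block_sum (coef_sum_widen _ (n := M K))// (leq_trans (size_polyMleq _ _))//.
by rewrite size_polyXn addnS/= (leq_trans _ (ltnW (M_lt kK)))// addnC leq_addr.
Qed.

Lemma block_sum_series_cvg F r t : 0 < r < 1 -> (forall n, `|F n t| <= 1) ->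
  series (fun k => block_sum F k r t) @ \oo -->
  limn (series (fun n => blocks_coef n * r ^+ n * F n t)).
Proof.
move=> r01 F1.
have /cvgrPdist_lt c := distribution_coefs_summable distribution_blocks_coef r01 F1.
apply/cvgrPdist_lt => e /c[N _ hN]; exists N => // K /= NK.
rewrite -[series _ K]/(\sum_(0 <= k < K) block_sum F k r t) -series_blocks_coef.
by apply: hN => /=; rewrite (leq_trans NK)// M_ge.
Qed.

(* Shifting by a large [M k] makes the radial extension of a block harmless:
   r^M P_k(r e(t)) differs from r^M P_k(e(t)) by at most sum_i i (P_k)_i / (M + 1). *)
Lemma block_sum_radial_bound F k r t : 0 < r < 1 -> (forall n, `|F n t| <= 1) ->
  `|block_sum F k r t| <= `|block_sum F k 1 t| + 2^-1 ^+ k.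
Proof.
move=> /andP[r0 r1] F1; have r01 : 0 <= r <= 1 by rewrite !ltW.
have [_ _ P_moment] := adm; rewrite !block_sumE.
set f1 := fun i => 1 ^+ _ * _; pose rest i := r ^+ M k * (1 - r ^+ i) * F (i + M k)%N t.
have -> : coef_sum (fun i => r ^+ (i + M k) * F (i + M k)%N t) (P k) =
    r ^+ M k * coef_sum f1 (P k) - coef_sum rest (P k).
  rewrite /coef_sum mulr_sumr -sumrB; apply: eq_bigr => i _.
  by rewrite /f1 /rest expr1n exprD; ring.
have rM0 : 0 <= r ^+ M k by rewrite exprn_ge0 ?ltW.
rewrite (le_trans (ler_normB _ _))// lerD//.
  by rewrite normrM ger0_norm// ler_piMl// exprn_ile1// ltW.
rewrite (le_trans (ler_norm_sum _ _ _))//.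
apply: (@le_trans _ _ (coef_sum (fun i => i%:R) (P k) / (M k).+1%:R)).
  rewrite /coef_sum mulr_suml; apply: ler_sum => i _.
  rewrite normrM [`|(P k)`_i|]ger0_norm// -[leRHS]mulrA ler_wpM2l//.
  rewrite /rest normrM -[leRHS]mulr1 ler_pM// ger0_norm ?exprn_onem_exprn_le//.
  by rewrite mulr_ge0// subr_ge0 exprn_ile1// ltW.
by rewrite ler_pdivrMr ?ltr0n.
Qed.

Lemma block_sum_radial_cvg F k t : block_sum F k r t @[r --> 1^'-] --> block_sum F k 1 t.
Proof.
apply: cvg_at_left_filter; rewrite /block_sum /coef_sum.
elim: (size (block k)) => [|n ih].
  by rewrite big_geq//; under eq_fun do rewrite big_geq//; exact: cvg_cst.
rewrite big_nat_recr//=; under eq_fun do rewrite big_nat_recr//=.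
apply: cvgD; first exact: ih.
by apply: cvgMr; apply: cvgMl; exact: exprn_continuous.
Qed.

Lemma measurable_block_sum F k r : (forall n, measurable_fun [set: R] (F n)) ->
  measurable_fun [set: R] (block_sum F k r).
Proof.
move=> mF; apply: measurable_sum => i.
by apply: measurable_funM => //; exact: measurable_funM.
Qed.

Lemma cmod_block_sum k t :
  cmod (block_sum ecos k 1 t) (block_sum esin k 1 t) = Num.sqrt (sqmod (P k) t).
Proof.
rewrite /cmod -(sqmodMXn _ (M k)) /sqmod; congr (Num.sqrt (_ ^+ 2 + _ ^+ 2));
  by apply: eq_bigr => i _; rewrite expr1n mul1r.
Qed.

End ShiftedBlocks.

Section LebesgueTransfer.
Context {R : realType}.
Implicit Types (A D : set R) (f : R -> R).
Local Notation mu := (@lebesgue_measure R).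

Lemma borel_measurable_LebT A : measurable A -> measurable (A : set (LebT R)).
Proof. by move=> mA; apply: sub_caratheodory. Qed.

Lemma measurable_fun_LebT (D : set (LebT R)) f :
  measurable_fun [set: R] f -> measurable_fun D (f : LebT R -> R).
Proof.
move=> mf; apply: measurable_funTS => _ Y mY; rewrite setTI.
by apply: borel_measurable_LebT; rewrite -[X in measurable X]setTI; exact: mf.
Qed.

Lemma Leb_integralE D f : measurable D -> measurable_fun [set: R] f -> (forall t, 0 <= f t) ->
  (\int[@completed_lebesgue_measure R]_(t in (D : set (LebT R))) (f t)%:E =
   \int[mu]_(t in D) (f t)%:E)%E.
Proof.
move=> mD mf f0.
have mid : measurable_fun [set: LebT R] (id : LebT R -> measurableTypeR R).
  by move=> _ Y mY; rewrite setTI; exact: sub_caratheodory.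
transitivity (\int[pushforward (@completed_lebesgue_measure R)
    (id : LebT R -> measurableTypeR R)]_(t in D) (f t)%:E)%E.
  rewrite ge0_integral_pushforward//.
  - by apply: measurable_funTS; exact/measurable_EFinP.
  - by move=> t _; rewrite lee_fin.
by apply: eq_measure_integral.
Qed.

Lemma ae_LebT (Q : R -> Prop) : {ae mu, forall t, Q t} ->
  {ae @completed_lebesgue_measure R, forall t : LebT R, Q t}.
Proof.
by move=> [N [mN N0 QN]]; exists N; split=> //; exact: borel_measurable_LebT.
Qed.

Lemma exists_borel_subset (E : set (LebT R)) : measurable E ->
  (0 < (@completed_lebesgue_measure R) (E `&` I01 R))%E ->
  exists X : set R, [/\ measurable X, X `<=` E, X `<=` unitI & (0 < mu X)%E].
Proof.
move=> mE E0; have mI : measurable (unitI : set R) := measurable_unitI.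
have : (completed_algebra_gen mu).-sigma.-measurable (E : set R).
  by rewrite completed_caratheodory_measurable.
rewrite g_sigma_completed_algebra_genE => -[/= X mX [N [N' [mN' N'0 NN']] XN]].
have mXI : measurable (X `&` unitI) by exact: measurableI.
exists (X `&` unitI); split=> //; [by move=> x [Xx _]; rewrite -XN; left|].
rewrite lt_neqAle measure_ge0 andbT eq_sym; apply/negP => /eqP X0.
suff : ((@completed_lebesgue_measure R) (E `&` I01 R) <= 0)%E by rewrite leNgt E0.
have U0 : mu ((X `&` unitI) `|` N') = 0%E.
  apply: measure_negligible; first exact: measurableU.
  by apply: negligibleU; apply/negligibleP.
rewrite -U0; apply: le_outer_measure => x [Ex Ix].
by move: Ex; rewrite -XN => -[Xx|/NN' N'x]; [left|right].
Qed.

Lemma exists_symset_subset (E : set (LebT R)) : measurable E ->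
  (forall x : R, E (- x) = E x) -> (forall x : R, E (x + 1) = E x) ->
  (0 < (@completed_lebesgue_measure R) (E `&` I01 R))%E ->
  exists2 B : set R, symset B & B `<=` E.
Proof.
move=> mE E_even E_periodic E0; have [X [mX XE XI muX]] := exists_borel_subset mE E0.
have mX' : measurable (reflection @^-1` X).
  by rewrite -[X in measurable X]setTI; exact: measurable_reflection.
exists (X `|` reflection @^-1` X); last first.
  move=> x [/XE//|/XE]; rewrite /reflection addrC (_ : (E (- x + 1) : Prop) = E x)//.
  by rewrite E_periodic E_even.
split.
- exact: measurableU.
- move=> x [/XI//|/XI]; rewrite /reflection /unitI/= !in_itv/=; lra.
- by move=> x [Xx|Xx]; [right; rewrite /= /reflection subKr|left].
- by apply: (lt_le_trans muX); apply: le_measure; rewrite ?inE//; exact: measurableU.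
Qed.

End LebesgueTransfer.

Section ComplexModulus.
Context {R : realType}.
Implicit Types (x y e : R) (f g : R -> R).

Lemma cmod_ge0 x y : 0 <= cmod x y.
Proof. exact: sqrtr_ge0. Qed.

Lemma cmod_le_add x y : cmod x y <= `|x| + `|y|.
Proof.
rewrite /cmod -[leRHS]ger0_norm ?addr_ge0// -sqrtr_sqr ler_wsqrtr//.
rewrite -(real_normK (num_real x)) -(real_normK (num_real y)).
by have := normr_ge0 x; have := normr_ge0 y; nra.
Qed.

Lemma norm_re_le_cmod x y : `|x| <= cmod x y.
Proof. by rewrite /cmod -sqrtr_sqr ler_wsqrtr// lerDl sqr_ge0. Qed.

Lemma norm_im_le_cmod x y : `|y| <= cmod x y.
Proof. by rewrite /cmod -sqrtr_sqr ler_wsqrtr// lerDr sqr_ge0. Qed.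

Lemma measurable_cmod f g : measurable_fun [set: R] f -> measurable_fun [set: R] g ->
  measurable_fun [set: R] (fun t => cmod (f t) (g t)).
Proof.
move=> mf mg; rewrite (_ : (fun t => _) = fun t => (f t * f t + g t * g t) `^ 2^-1).
  apply: (measurableT_comp (measurable_powR _)).
  by apply: measurable_funD; exact: measurable_funM.
by apply/funext => t; rewrite /cmod -!expr2 powR12_sqrt// addr_ge0 ?sqr_ge0.
Qed.

End ComplexModulus.

Section LacunarySeries.
Context {R : realType} (P : nat -> {poly R}) (M : nat -> nat).
Hypotheses (P_ge0 : forall k i, 0 <= (P k)`_i) (adm : admissible_shifts P M).
Implicit Types (F : nat -> R -> R) (D : set R) (e q p r t y : R) (j k n : nat).
Local Notation mu := (@lebesgue_measure R).
Local Notation a := (blocks_coef P M).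

Definition block_mod k t : R := Num.sqrt (sqmod (P k) t).

Lemma block_mod_powR k t e : block_mod k t `^ e = sqmod (P k) t `^ (e / 2).
Proof. by rewrite /block_mod -powR12_sqrt ?sqmod_ge0// -powRrM mulrC. Qed.

Lemma measurable_block_mod k : measurable_fun [set: R] (block_mod k).
Proof.
have half_ge0 : 0 <= (2^-1 : R) by rewrite invr_ge0.
have [m _] := bounded_mfun_sqmod_powR (P k) half_ge0.
rewrite (_ : block_mod k = fun x => sqmod (P k) x `^ 2^-1)//.
by apply/funext => x; rewrite /block_mod -powR12_sqrt ?sqmod_ge0.
Qed.

Lemma block_sum_le_mod k t : `|block_sum P M ecos k 1 t| <= block_mod k t /\
  `|block_sum P M esin k 1 t| <= block_mod k t.
Proof.
by rewrite /block_mod -(cmod_block_sum P M); split;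
  [exact: norm_re_le_cmod|exact: norm_im_le_cmod].
Qed.

Definition boundary F t : R := series_limit (fun k => block_sum P M F k 1) t.

Lemma measurable_boundary F : (forall n, measurable_fun [set: R] (F n)) ->
  measurable_fun [set: R] (boundary F).
Proof. by move=> mF; apply: measurable_series_limit => k; exact: measurable_block_sum. Qed.

Lemma measurable_radial F r : 0 < r < 1 -> (forall n t, `|F n t| <= 1) ->
  (forall n, measurable_fun [set: R] (F n)) ->
  measurable_fun [set: R] (fun t => limn (series (fun n => a n * r ^+ n * F n t))).
Proof.
move=> r01 F1 mF.
apply: (@measurable_fun_cvg _ _ _ setT (fun n t => series (fun k => block_sum P M F k r t) n)).
  by move=> n; apply: measurable_sum => k; exact: measurable_block_sum.
by move=> t _; exact: block_sum_series_cvg.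
Qed.

Let mecos n : measurable_fun [set: R] (@ecos R n).
Proof. by have [] := @bounded_mfun_ecos R n. Qed.

Let mesin n : measurable_fun [set: R] (@esin R n).
Proof. by have [] := @bounded_mfun_esin R n. Qed.

Lemma measurable_cmod_radial r : 0 < r < 1 ->
  measurable_fun [set: R] (fun t => cmod (fr_re a r t) (fr_im a r t)).
Proof.
move=> r01; apply: measurable_cmod; apply: measurable_radial => //.
  by move=> n t; exact: ecos_norm.
by move=> n t; exact: esin_norm.
Qed.

Lemma measurable_cmod_boundary :
  measurable_fun [set: R] (fun t => cmod (boundary ecos t) (boundary esin t)).
Proof. by apply: measurable_cmod; exact: measurable_boundary. Qed.

Lemma radial_le F r t y : 0 < r < 1 -> (forall n, `|F n t| <= 1) ->
  (forall k, `|block_sum P M F k 1 t| <= y * 2^-1 ^+ k) ->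
  `|limn (series (fun n => a n * r ^+ n * F n t))| <= 2 * (1 + y).
Proof.
move=> r01 F1 Fy.
rewrite -(cvg_lim (@Rhausdorff R) (block_sum_series_cvg P_ge0 adm r01 F1)).
apply: norm_lim_series_half => k; rewrite mulrDl mul1r addrC.
by rewrite (le_trans (block_sum_radial_bound P_ge0 adm k r01 F1))// lerD.
Qed.

Lemma radial_cvg_boundary F t y : (forall n, `|F n t| <= 1) ->
  (forall k, `|block_sum P M F k 1 t| <= y * 2^-1 ^+ k) ->
  limn (series (fun n => a n * r ^+ n * F n t)) @[r --> 1^'-] --> boundary F t.
Proof.
move=> F1 Fy; rewrite /boundary series_limitE; last exact: series_half_cvg Fy.
have near01 : \forall r \near (1 : R)^'-, 0 < r < 1.
  near=> r; apply/andP; split; near: r; last exact: nbhs_left_lt.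
  exact: nbhs_left_gt.
have : limn (series (fun k => block_sum P M F k r t)) @[r --> 1^'-] -->
    limn (series (fun k => block_sum P M F k 1 t)).
  apply: (@tannery _ _ _ _ (fun k r => block_sum P M F k r t) _
      (fun k => (y + 1) * 2^-1 ^+ k)).
  - exact: (cvgP _ (@cvg_series_half R (y + 1))).
  - by move=> k; exact: block_sum_radial_cvg.
  - apply: filterS near01 => r r01 k; rewrite mulrDl mul1r.
    by rewrite (le_trans (block_sum_radial_bound P_ge0 adm k r01 F1))// lerD.
apply: cvg_trans; apply: near_eq_cvg; apply: filterS near01 => r r01.
exact: (cvg_lim (@Rhausdorff R) (block_sum_series_cvg P_ge0 adm r01 F1)).
Unshelve. all: by end_near. Qed.

Lemma cmod_radial_le r t y : 0 < r < 1 -> (forall k, block_mod k t <= y * 2^-1 ^+ k) ->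
  cmod (fr_re a r t) (fr_im a r t) <= 4 * (1 + y).
Proof.
move=> r01 Ay; apply: (le_trans (cmod_le_add _ _)).
rewrite (_ : 4 * (1 + y) = 2 * (1 + y) + 2 * (1 + y)); last by ring.
apply: lerD.
- apply: (@radial_le ecos r t y r01) => [n|k]; first exact: ecos_norm.
  exact: le_trans (block_sum_le_mod k t).1 (Ay k).
- apply: (@radial_le esin r t y r01) => [n|k]; first exact: esin_norm.
  exact: le_trans (block_sum_le_mod k t).2 (Ay k).
Qed.

Lemma boundary_le F t y : (forall k, `|block_sum P M F k 1 t| <= y * 2^-1 ^+ k) ->
  `|boundary F t| <= 2 * y.
Proof.
move=> Fy; rewrite /boundary series_limitE; last exact: series_half_cvg Fy.
exact: norm_lim_series_half.
Qed.

Lemma cmod_boundary_le t y : (forall k, block_mod k t <= y * 2^-1 ^+ k) ->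
  cmod (boundary ecos t) (boundary esin t) <= 4 * y.
Proof.
move=> Ay; apply: (le_trans (cmod_le_add _ _)).
rewrite (_ : 4 * y = 2 * y + 2 * y); last by ring.
apply: lerD; apply: boundary_le => k.
- exact: le_trans (block_sum_le_mod k t).1 (Ay k).
- exact: le_trans (block_sum_le_mod k t).2 (Ay k).
Qed.

Lemma block_sum_le_boundary F k t y : 0 <= y ->
  (forall j, j != k -> `|block_sum P M F j 1 t| <= y * 2^-1 ^+ j) ->
  `|block_sum P M F k 1 t| <= `|boundary F t| + 2 * y.
Proof.
move=> y0 /(series_half_off_one y0)[cv le_k].
by rewrite /boundary series_limitE.
Qed.

Lemma block_mod_le_boundary k t y : 0 <= y ->
  (forall j, j != k -> block_mod j t <= y * 2^-1 ^+ j) ->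
  block_mod k t <= 4 * (cmod (boundary ecos t) (boundary esin t) + y).
Proof.
move=> y0 Ay; rewrite /block_mod -(cmod_block_sum P M); apply: (le_trans (cmod_le_add _ _)).
have re_le : `|block_sum P M ecos k 1 t| <= `|boundary ecos t| + 2 * y.
  by apply: block_sum_le_boundary => // j /Ay; exact: le_trans (block_sum_le_mod j t).1.
have im_le : `|block_sum P M esin k 1 t| <= `|boundary esin t| + 2 * y.
  by apply: block_sum_le_boundary => // j /Ay; exact: le_trans (block_sum_le_mod j t).2.
have := norm_re_le_cmod (boundary ecos t) (boundary esin t).
have := norm_im_le_cmod (boundary ecos t) (boundary esin t).
have := cmod_ge0 (boundary ecos t) (boundary esin t).
by move: re_le im_le; clear; lra.
Qed.

Definition block_mod_small e D := forall k,
  (\int[mu]_(t in D) ((block_mod k t) `^ e)%:E <= (dyadic_tolerance e k)%:E)%E.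

Let block_mod_ge0 k t : 0 <= block_mod k t.
Proof. exact: sqrtr_ge0. Qed.

Lemma blocks_in_Hardy q : 0 < q -> block_mod_small q unitI -> in_Hardy q a.
Proof.
move=> q0 small; split; first exact: distribution_blocks_coef.
exists (8 `^ q * 2) => r r01; have mI : measurable (unitI : set R) := measurable_unitI.
have mr := measurable_cmod_radial r01.
rewrite (@Leb_integralE R unitI)//; last by move=> t; exact: powR_ge0.
  apply: (le_trans (@integral_powR_le_dyadic _ _ R mu q block_mod unitI q0
    measurable_block_mod block_mod_ge0 mI small _ (cst 1) mr _ _ _ _)) => //.
  - by move=> t; exact: cmod_ge0.
  - by move=> t y _ _; exact: cmod_radial_le.
  under eq_integral do rewrite powR1.
  rewrite integral_cst// -[X in (_ * (_ * X + _))%E]/(mu unitI) lebesgue_measure_unitI mule1 EFinM.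
  by rewrite -EFinD.
exact: (measurableT_comp (measurable_powR q)).
Qed.

Lemma blocks_boundary_value q : 0 < q -> block_mod_small q unitI ->
  boundary_value a (boundary ecos) (boundary esin).
Proof.
move=> q0 small; split; first by apply: measurable_fun_LebT; exact: measurable_boundary.
split; first by apply: measurable_fun_LebT; exact: measurable_boundary.
apply: ae_LebT; have mI : measurable (unitI : set R) := measurable_unitI.
have := @ae_dyadic_bound _ _ R mu q block_mod unitI q0 measurable_block_mod
  block_mod_ge0 mI small.
apply: filterS => t bound It; have [y y0 Ay] := bound It; split.
- apply: (@radial_cvg_boundary ecos t y) => [n|k]; first exact: ecos_norm.
  exact: le_trans (block_sum_le_mod k t).1 (Ay k).
- apply: (@radial_cvg_boundary esin t y) => [n|k]; first exact: esin_norm.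
  exact: le_trans (block_sum_le_mod k t).2 (Ay k).
Qed.

Lemma boundary_Lp_off p D : 0 < p -> measurable D -> block_mod_small p D ->
  (\int[mu]_(t in D) ((cmod (boundary ecos t) (boundary esin t)) `^ p)%:E < +oo)%E.
Proof.
move=> p0 mD small.
apply: (le_lt_trans (@integral_powR_le_dyadic _ _ R mu p block_mod D p0
  measurable_block_mod block_mod_ge0 mD small _ (cst 0) measurable_cmod_boundary _ _ _ _)) => //.
- by move=> t; exact: cmod_ge0.
- by move=> t y _ _ Ay; rewrite add0r; exact: cmod_boundary_le.
under eq_integral do rewrite powR0 ?gt_eqF//.
by rewrite integral0 add0e mule1 ltry.
Qed.

Lemma block_mod_Lp_le k p D : 0 < p -> measurable D ->
  (forall j, j != k ->
    (\int[mu]_(t in D) ((block_mod j t) `^ p)%:E <= (dyadic_tolerance p j)%:E)%E) ->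
  (\int[mu]_(t in D) ((block_mod k t) `^ p)%:E <= (8 `^ p)%:E *
    (\int[mu]_(t in D) ((cmod (boundary ecos t) (boundary esin t)) `^ p)%:E + 1))%E.
Proof.
move=> p0 mD small; pose other j t := if j == k then 0 else block_mod j t.
apply: (@integral_powR_le_dyadic _ _ _ mu p other D) => //.
- by move=> j; rewrite /other; case: eqP => _; [exact: measurable_cst|exact: measurable_block_mod].
- by move=> j t; rewrite /other; case: eqP.
- move=> j; rewrite /other; have [_|/small//] := eqVneq j k.
  under eq_integral do rewrite powR0 ?gt_eqF//.
  by rewrite integral0 lee_fin divr_ge0 ?powR_ge0 ?invr_ge0.
- exact: measurable_block_mod.
- exact: measurable_cmod_boundary.
- by move=> t; exact: cmod_ge0.
- move=> t y _ y0 other_le; apply: block_mod_le_boundary => // j jk.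
  by have := other_le j; rewrite /other (negbTE jk).
Qed.

End LacunarySeries.

Section Construction.
Context {R : realType}.
Implicit Types (B D : set R) (e p q : R) (k : nat).
Local Notation mu := (@lebesgue_measure R).

Lemma dyadic_tolerance_gt0 e k : 0 < dyadic_tolerance e k.
Proof. by rewrite divr_gt0 ?invr_gt0 ?ltr0n ?expn_gt0// powR_gt0// exprn_gt0. Qed.

Lemma le_dyadic_tolerance q p k : q <= p -> dyadic_tolerance p k <= dyadic_tolerance q k.
Proof.
move=> qp; rewrite ler_wpM2l ?invr_ge0// lef_pV2 ?posrE ?powR_gt0 ?exprn_gt0//.
by rewrite ler_powR// exprn_ege1// ler1n.
Qed.

Lemma integral_block_mod_powR (P : nat -> {poly R}) k e D : measurable D -> D `<=` unitI ->
  0 <= e -> (\int[mu]_(t in D) ((block_mod P k t) `^ e)%:E =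
    (mean (fun t => \1_D t * sqmod (P k) t `^ (e / 2)))%:E)%E.
Proof.
move=> mD DI e0; under eq_integral do rewrite block_mod_powR.
by rewrite integral_mean_indic//; apply: bounded_mfun_sqmod_powR; rewrite divr_ge0.
Qed.

Lemma exists_concentrated_blocks p q B : 0 < q < p -> (forall n : nat, p / 2 != n%:R) ->
  symset B -> exists (P : nat -> {poly R}) (F : nat -> set R), [/\
    forall k, gapped k (P k),
    forall k, [/\ measurable (F k), F k `<=` unitI, F k `<=` B &
      forall j, j != k -> F k `<=` ~` F j],
    forall k, (k.+1%:R%:E <= \int[mu]_(t in F k) ((block_mod P k t) `^ p)%:E)%E,
    forall k D, measurable D -> D `<=` unitI -> D `<=` ~` F k ->
      (\int[mu]_(t in D) ((block_mod P k t) `^ p)%:E <= (dyadic_tolerance p k)%:E)%E &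
    block_mod_small P q unitI].
Proof.
move=> /andP[q0 qp] p_nat sB; have p0 : 0 < p := lt_trans q0 qp.
have p20 : 0 < p / 2 by rewrite divr_gt0.
have qp2 : 0 < q / 2 < p / 2 by rewrite divr_gt0//= ltr_pM2r.
have [F [sF FB Fdisj]] := disjoint_symsets sB.
have mF k : measurable (F k) by have [] := sF k.
have FI k : F k `<=` unitI by have [] := sF k.
have /choice[P hP] : forall k, exists P : {poly R}, [/\ gapped k P,
    k.+1%:R <= mean (fun x => \1_(F k) x * sqmod P x `^ (p / 2)),
    mean (fun x => \1_(~` F k) x * sqmod P x `^ (p / 2)) <= dyadic_tolerance p k &
    mean (fun x => sqmod P x `^ (q / 2)) <= dyadic_tolerance p k].
  by move=> k; apply: exists_concentrated_poly_small => //; exact: dyadic_tolerance_gt0.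
exists P, F; split.
- by move=> k; have [] := hP k.
- by move=> k; split=> // j jk; apply: Fdisj; rewrite eq_sym.
- move=> k; rewrite integral_block_mod_powR ?(ltW p0)// lee_fin.
  by have [] := hP k.
- move=> k D mD DI DF; rewrite integral_block_mod_powR ?(ltW p0)// lee_fin.
  have [_ _ + _] := hP k; apply: le_trans.
  have bP := bounded_mfun_sqmod_powR (P k) (ltW p20).
  have bD := bounded_mfun_indic mD; have bF := bounded_mfun_indic (measurableC (mF k)).
  apply: le_mean => [||x _]; [exact: bounded_mfunM|exact: bounded_mfunM|].
  by rewrite ler_wpM2r ?powR_ge0// le_indic.
- move=> k; rewrite integral_block_mod_powR ?(ltW q0)//; last exact: measurable_unitI.
  have [_ _ _] := hP k; rewrite lee_fin (@eq_mean _ _ (fun x => sqmod (P k) x `^ (q / 2))).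
    by move=> /le_trans; apply; exact: le_dyadic_tolerance (ltW qp).
  by move=> x Ix; rewrite indicE mem_set// mul1r.
Qed.

Lemma EFin_unbounded (x : \bar R) (c : R) : (0 <= x)%E -> 0 <= c ->
  (forall k, (k.+1%:R%:E <= c%:E * (x + 1))%E) -> x = +oo%E.
Proof.
move=> x0 c0 large; apply/eqP; rewrite eq_le leey leNgt; apply/negP => x_fin.
have fx : x \is a fin_num by rewrite ge0_fin_numE.
have := large (Num.bound (c * (fine x + 1))).
rewrite -(fineK fx) -EFinD -EFinM lee_fin leNgt => /negP; apply.
rewrite (lt_trans (archi_boundP _)) ?ltr_nat//.
by rewrite mulr_ge0// addr_ge0// fine_ge0.
Qed.

Theorem exists_lacunary_Hardy p q B : 0 < q < p -> (forall n : nat, p / 2 != n%:R) ->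
  symset B -> exists (a : nat -> R) (gre gim : R -> R), [/\
    forall n, 0 <= a n, in_Hardy q a, gaps_to_infty a & [/\ boundary_value a gre gim,
      measurable_fun [set: R] (fun t => cmod (gre t) (gim t)),
      (\int[mu]_(t in unitI `\` B) ((cmod (gre t) (gim t)) `^ p)%:E < +oo)%E &
      (\int[mu]_(t in unitI) ((cmod (gre t) (gim t)) `^ p)%:E = +oo)%E]].
Proof.
move=> qp p_nat sB; have /andP[q0 /(lt_trans q0) p0] := qp; have [mB BI _ _] := sB.
have mI : measurable (unitI : set R) := measurable_unitI.
have [P [F [gP hF PF Poff Pq]]] := exists_concentrated_blocks qp p_nat sB.
have P_ge0 k i : 0 <= (P k)`_i by have [] := gP k.
have [M adm] := exists_admissible_shifts P_ge0.
exists (blocks_coef P M), (boundary P M ecos), (boundary P M esin); split.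
- exact: blocks_coef_ge0.
- exact: blocks_in_Hardy.
- by apply: gaps_blocks_coef => // [k|k]; have [_ Pk0 gap] := gP k; [exact: gap|rewrite gt_eqF].
set g := fun t => cmod _ _; have mg : measurable_fun [set: R] g by exact: measurable_cmod_boundary.
have mgp D : measurable_fun D (fun t => ((g t) `^ p)%:E).
  apply: measurable_funTS; apply/measurable_EFinP.
  exact: (measurableT_comp (measurable_powR p)).
split=> //; first exact: blocks_boundary_value Pq.
  apply: boundary_Lp_off => //; first exact: measurableD.
  move=> k; apply: Poff => [||t [_ nB] Ft]; [exact: measurableD|by move=> t []|].
  by have [_ _ FB _] := hF k; exact: nB (FB t Ft).
apply: (@EFin_unbounded _ (8 `^ p)) => [||k]; [|exact: powR_ge0|].
  by apply: integral_ge0 => t _; rewrite lee_fin powR_ge0.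
have [mF FI _ Fdisj] := hF k; apply: (le_trans (PF k)).
apply: (@le_trans _ _ ((8 `^ p)%:E * (\int[mu]_(t in F k) ((g t) `^ p)%:E + 1))%E).
  apply: block_mod_Lp_le => // j jk; apply: Poff => //; exact: Fdisj.
rewrite lee_wpmul2l ?lee_fin ?powR_ge0// leeD2r//.
apply: ge0_subset_integral; [exact: mF|exact: mI|exact: mgp| |exact: FI].
by move=> t _; rewrite lee_fin powR_ge0.
Qed.

End Construction.

Theorem theorem4 (R : realType) (p : R) :
  0 < p -> ~ (exists k : nat, p = 2 * k%:R) ->
  forall E : set (LebT R),
    measurable E ->
    (forall x : R, E (- x) = E x) ->
    (forall x : R, E (x + 1) = E x) ->
    (0 < Leb (E `&` I01 R))%E ->
  forall q : R, 0 < q < p ->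
  exists a : nat -> R,
    (forall n, 0 <= a n) /\
    in_Hardy q a /\
    gaps_to_infty a /\
    exists gre gim : R -> R,
      boundary_value a gre gim /\
      (\int[Leb]_(t in I01 R `\` E) ((cmod (gre t) (gim t)) `^ p)%:E < +oo)%E /\
      (\int[Leb]_(t in I01 R) ((cmod (gre t) (gim t)) `^ p)%:E = +oo)%E.
Proof.
move=> p0 p_even E mE E_even E_periodic E0 q qp.
have p_nat (k : nat) : p / 2 != k%:R.
  by apply/eqP => pk; apply: p_even; exists k; rewrite -pk mulrC divfK.
have [B sB BE] := exists_symset_subset mE E_even E_periodic E0; have [mB _ _ _] := sB.
have [a [gre [gim [a0 aq gaps [bv mg off_B on_I]]]]] := exists_lacunary_Hardy qp p_nat sB.
have mgp := measurableT_comp (measurable_powR p) mg.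
exists a; split=> //; split=> //; split=> //; exists gre, gim; split=> //.
have gp0 t : 0 <= (cmod (gre t) (gim t)) `^ p by exact: powR_ge0.
split; last by rewrite (@Leb_integralE R unitI)//; exact: measurable_unitI.
have mIB : measurable (unitI `\` B) by apply: measurableD => //; exact: measurable_unitI.
rewrite -(@Leb_integralE R _ _ mIB mgp gp0) in off_B; apply: le_lt_trans off_B.
apply: ge0_subset_integral.
- by apply: measurableD => //; apply: borel_measurable_LebT; exact: measurable_unitI.
- exact: borel_measurable_LebT.
- by apply/measurable_EFinP; exact: measurable_fun_LebT.
- by move=> t _; rewrite lee_fin.
- by move=> t [It nE]; split=> // /BE.
Qed.
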